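(* Let $(X,d)$ be a uniformly locally finite metric space. The following are equivalent: (1) There are no non-compact block ghost projections in $\mathrm{C}^*_u(X)$ (i.e. no non-compact projections in $\mathrm{C}^*_u(X)$ that are both block projections and ghosts). (2) If $X'\subseteq X$ is sparse, then all ghost projections in $\mathrm{C}^*_u(X')$ are compact. (3) $X$ has the operator norm localization property (ONL) for equi-approximable finite-rank projections.
   Context: A metric space $(X,d)$ is uniformly locally finite (u.l.f.) if for each $r>0$ there is $N$ such that every ball of radius $r$ has at most $N$ elements. $\ell_2(X)$ has canonical orthonormal basis $(\delta_x)_{x\in X}$; for $A\subseteq X$, $\chi_A$ is the orthogonal projection onto $\ell_2(A)\subseteq\ell_2(X)$. For $a\in\mathcal B(\ell_2(X))$ put $a_{x,z}=\langle a\delta_z,\delta_x\rangle$ and $\mathrm{prop}(a)=\sup\{d(x,y)\mid\langle a\delta_x,\delta_y\rangle\ne0\}$. The uniform Roe algebra $\mathrm{C}^*_u(X)$ is the norm closure in $\mathcal B(\ell_2(X))$ of the operators with finite propagation. Subsets $X'\subseteq X$ carry the restricted metric, and $\mathrm{C}^*_u(X')\subseteq\mathcal B(\ell_2(X'))$. ''Projection'' means self-adjoint idempotent operator. Ghost: $a\in\mathrm{C}^*_u(X)$ is a ghost if for all $\varepsilon>0$ there is a finite $A\subseteq X$ with $|a_{x,z}|\le\varepsilon$ for all $x,z\notin A$. Block projection: a projection $p\in\mathrm{C}^*_u(X)$ is a block projection if there is a disjoint sequence $(X_n)_{n\in\mathbb N}$ of finite non-empty subsets of $X$ with $p=\sum_n\chi_{X_n}p\chi_{X_n}$,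 the sum converging in the strong operator topology. Sparse: $X'\subseteq X$ is sparse if $X'=\bigsqcup_nX_n$ with each $X_n$ finite and $d(X_n,X_m)\to\infty$ as $n+m\to\infty$ (over $n\neq m$). Equi-approximable: $S\subseteq\mathrm{C}^*_u(X)$ is equi-approximable if for all $\varepsilon>0$ there is $s>0$ such that for all $a\in S$ there is $b\in\mathcal B(\ell_2(X))$ with $\mathrm{prop}(b)\le s$ and $\|a-b\|\le\varepsilon$. ONL for equi-approximable finite-rank projections: for all $\varepsilon>0$ and all equi-approximable families $S\subseteq\mathrm{C}^*_u(X)$ consisting of finite-rank projections, there is $s>0$ such that for all $a\in S$ some unit vector $\xi\in\ell_2(X)$ satisfies $\mathrm{diam}(\mathrm{supp}(\xi))\le s$ and $\|a\xi\|\ge(1-\varepsilon)\|a\|$. *)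

(* Defs.v *)
From HB Require Import structures.
From mathcomp Require Import all_boot all_order all_algebra.
From mathcomp Require Import all_classical all_reals all_analysis.
From mathcomp Require Import complex ring.

Set Implicit Arguments.
Unset Strict Implicit.
Unset Printing Implicit Defensive.

Import Order.TTheory GRing.Theory Num.Theory.
Import numFieldNormedType.Exports.
Import Normc.

Local Open Scope classical_set_scope.
Local Open Scope ring_scope.
Local Open Scope complex_scope.

(* The restriction of the ambient metric to a subset; the type of points of
   A : set X is the coercion of A to set_type A. *)
Section restricted_metric.
Context {R : realType} {X : metricType R} (A : set X).

Let sub_mdist (x y : A) : R := mdist (\val x) (\val y).

Let sub_mdist_ge0 x y : 0 <= sub_mdist x y.
Proof. exact: mdist_ge0. Qed.

Let sub_mdist_positivity x y : sub_mdist x y = 0 -> x = y.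
Proof. by move=> /mdist_positivity/val_inj. Qed.

Let sub_ballE (x : A) (r : R) : ball x r = [set y | sub_mdist x y < r].
Proof.
apply/seteqP; split => y; rewrite /sub_mdist.
  rewrite -[ball x r y]/(ball (\val x) r (\val y)).
  by rewrite ballEmdist.
rewrite -[ball x r y]/(ball (\val x) r (\val y)).
by rewrite ballEmdist.
Qed.

HB.instance Definition _ := @PseudoMetric_isMetric.Build R (A : Type)
  sub_mdist sub_mdist_ge0 sub_mdist_positivity sub_ballE.

End restricted_metric.

Section normc_lemmas.
Context {R : rcfType}.
Implicit Types z w : R[i].

Lemma normc_ge0 z : 0 <= normc z.
Proof. by case: z => a b; exact: sqrtr_ge0. Qed.

Lemma ler_normcD z w : normc (z + w) <= normc z + normc w.
Proof. exact: (@le_normcD R z w). Qed.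

End normc_lemmas.

Section ell2_def.
Context {R : realType} {X : choiceType}.
Implicit Types f g : X -> R[i].

Definition sqsum f : \bar R :=
  (\esum_(x in [set: X]) (normc (f x) ^+ 2)%:E)%E.

Lemma sqsum_ge0 f : (0 <= sqsum f)%E.
Proof. by apply: esum_ge0 => x _; rewrite lee_fin sqr_ge0. Qed.

Definition sqsummable : {pred X -> R[i]} := mem [set f | (sqsum f < +oo)%E].

Lemma sqsum_fin f : f \in sqsummable -> sqsum f \is a fin_num.
Proof. by rewrite inE/= ge0_fin_numE// sqsum_ge0. Qed.

Lemma esumZl (k : R) (a : X -> R) : 0 <= k -> (forall x, 0 <= a x) ->
  (\esum_(x in [set: X]) (k * a x)%:E = k%:E * \esum_(x in [set: X]) (a x)%:E)%E.
Proof.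
move=> k0 a0.
rewrite /esum -ereal_supZl//; last first.
  apply/set0P; exists 0%E; exists set0; first exact: fsets_set0.
  by rewrite fsbig_set0.
congr ereal_sup; apply/seteqP; split => y /=.
  move=> [A fA <-]; exists (\sum_(x \in A) (a x)%:E)%E; first by exists A.
  by rewrite ge0_mule_fsumr// => x; rewrite lee_fin.
move=> [_ [A fA <-] <-]; exists A => //.
by rewrite ge0_mule_fsumr// => x; rewrite lee_fin.
Qed.

Lemma sqsumZ (c : R[i]) f : sqsum (c *: f) = ((normc c ^+ 2)%:E * sqsum f)%E.
Proof.
rewrite /sqsum -esumZl ?sqr_ge0//; last by move=> x; exact: sqr_ge0.
by apply: eq_esum => x _; rewrite -exprMn -normcM.
Qed.

Lemma sqsumD_le (s t : R) f g : 0 < s -> 0 < t ->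
  (sqsum (f + g)%R <= ((s + t) / s)%:E * sqsum f + ((s + t) / t)%:E * sqsum g)%E.
Proof.
move=> s0 t0.
have st0 : 0 < s + t by exact: addr_gt0.
rewrite /sqsum -esumZl; first last.
- by move=> x; exact: sqr_ge0.
- by rewrite divr_ge0// ltW.
rewrite -esumZl; first last.
- by move=> x; exact: sqr_ge0.
- by rewrite divr_ge0// ltW.
rewrite -esumD; first last.
- by move=> x _; rewrite lee_fin mulr_ge0// ?sqr_ge0// divr_ge0// ltW.
- by move=> x _; rewrite lee_fin mulr_ge0// ?sqr_ge0// divr_ge0// ltW.
apply: le_esum => x _; rewrite -EFinD lee_fin.
have := ler_normcD (f x) (g x).
have := normc_ge0 (f x + g x); have := normc_ge0 (f x); have := normc_ge0 (g x).
rewrite -[(f + g) x]/(f x + g x).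
move: (normc (f x)) (normc (g x)) (normc (f x + g x)) => a b c b0 a0 c0 cab.
apply: (@le_trans _ _ ((a + b) ^+ 2)).
  by rewrite ler_sqr ?nnegrE// addr_ge0.
rewrite -subr_ge0.
have -> : (s + t) / s * a ^+ 2 + (s + t) / t * b ^+ 2 - (a + b) ^+ 2
  = (t * a - s * b) ^+ 2 / (s * t).
  by field; rewrite !gt_eqF.
by rewrite divr_ge0 ?sqr_ge0// mulr_ge0// ltW.
Qed.

Lemma sqsummable_submod_closed : submod_closed sqsummable.
Proof.
split.
  rewrite inE/= /sqsum esum1 ?ltry// => x _.
  by rewrite -[0 x]/0 normc0 expr0n.
move=> c f g; rewrite !inE/= => f2 g2.
apply: le_lt_trans (@sqsumD_le 1 1 _ _ ltr01 ltr01) _.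
rewrite lte_add_pinfty//.
  rewrite sqsumZ muleA -EFinM lte_mul_pinfty//.
  by rewrite lee_fin mulr_ge0 ?sqr_ge0// divr_ge0.
by rewrite lte_mul_pinfty// lee_fin divr_ge0.
Qed.

HB.instance Definition _ :=
  GRing.isSubmodClosed.Build _ _ sqsummable sqsummable_submod_closed.

End ell2_def.

Record ell2 (R : realType) (X : choiceType) : Type := Ell2 {
  ell2_fun :> X -> R[i];
  ell2P : ell2_fun \in sqsummable }.
Arguments ell2 : clear implicits.

Section ell2_module.
Context (R : realType) (X : choiceType).

HB.instance Definition _ := [isSub for @ell2_fun R X].
HB.instance Definition _ := [Choice of ell2 R X by <:].
HB.instance Definition _ := [SubChoice_isSubLmodule of ell2 R X by <:].

End ell2_module.

Section ell2_norm.
Context {R : realType} {X : choiceType}.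
Implicit Types xi eta : ell2 R X.

Definition l2norm xi : R := Num.sqrt (fine (sqsum xi)).

Lemma ell2P_eq xi eta : (forall x, xi x = eta x) -> xi = eta.
Proof. by move=> e; apply/val_inj/funext. Qed.

Lemma l2norm_ge0 xi : 0 <= l2norm xi. Proof. exact: sqrtr_ge0. Qed.

Lemma l2norm_sqr xi : (l2norm xi ^+ 2)%:E = sqsum xi.
Proof.
by rewrite sqr_sqrtr ?fine_ge0 ?sqsum_ge0// fineK// sqsum_fin// ell2P.
Qed.

Lemma normc_le_l2norm xi x : normc (xi x) <= l2norm xi.
Proof.
rewrite -ler_sqr ?nnegrE ?normc_ge0 ?l2norm_ge0// -lee_fin l2norm_sqr.
apply: esum_ge; exists [set x]; last by rewrite fsbig_set1.
by split => //; exact: finite_set1.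
Qed.

Lemma l2norm0_eq0 xi : l2norm xi = 0 -> xi = 0.
Proof.
move=> xi0; apply: ell2P_eq => x.
apply: eq0_normc; apply/eqP; rewrite eq_le normc_ge0 andbT -xi0.
exact: normc_le_l2norm.
Qed.

Lemma l2normZ (c : R[i]) xi : l2norm (c *: xi) = normc c * l2norm xi.
Proof.
apply/eqP; rewrite -(@eqrXn2 _ 2)//; last 2 first.
- exact: sqrtr_ge0.
- by rewrite mulr_ge0 ?normc_ge0 ?l2norm_ge0.
by rewrite -eqe l2norm_sqr exprMn EFinM l2norm_sqr -sqsumZ.
Qed.

Lemma ler_l2normD xi eta : l2norm (xi + eta) <= l2norm xi + l2norm eta.
Proof.
have [x0|] := eqVneq (l2norm xi) 0.
  by rewrite (l2norm0_eq0 x0) add0r lerDr l2norm_ge0.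
have [y0|] := eqVneq (l2norm eta) 0.
  by rewrite (l2norm0_eq0 y0) addr0 lerDl l2norm_ge0.
move=> y0 x0.
have {}x0 : 0 < l2norm xi by rewrite lt_neqAle eq_sym x0 l2norm_ge0.
have {}y0 : 0 < l2norm eta by rewrite lt_neqAle eq_sym y0 l2norm_ge0.
rewrite -ler_sqr ?nnegrE ?l2norm_ge0 ?addr_ge0 ?l2norm_ge0//.
rewrite -lee_fin l2norm_sqr.
apply: le_trans (sqsumD_le _ _ x0 y0) _.
rewrite -!l2norm_sqr -!EFinM -EFinD lee_fin.
by rewrite le_eqVlt; apply/orP; left; apply/eqP; field; rewrite !gt_eqF.
Qed.

Let norm xi : R[i] := (l2norm xi)%:C.

Let normD xi eta : norm (xi + eta) <= norm xi + norm eta.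
Proof. by rewrite -rmorphD/= lecR ler_l2normD. Qed.

Let normZ c xi : norm (c *: xi) = `|c| * norm xi.
Proof. by rewrite /norm l2normZ rmorphM/=; congr (_ * _). Qed.

Let norm0_eq0 xi : norm xi = 0 -> xi = 0.
Proof. by move=> /complexI/l2norm0_eq0. Qed.

HB.instance Definition _ := @Lmodule_isNormed.Build R[i] (ell2 R X)
  norm normD normZ norm0_eq0.

Lemma ell2_normE xi : `|xi| = (l2norm xi)%:C. Proof. by []. Qed.

End ell2_norm.

Section bounded_operators.
Context {R : realType} {X : choiceType}.
Local Notation H := (ell2 R X).

Definition bounded_op : {pred H -> H} :=
  mem [set T | linear T /\
               exists M : R, forall xi, l2norm (T xi) <= M * l2norm xi].

Lemma bounded_op_submod_closed : submod_closed bounded_op.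
Proof.
split.
  rewrite inE/=; split.
    by move=> c xi eta; rewrite -![0 _]/0 scaler0 addr0.
  exists 0 => xi; rewrite -[0 xi]/0 mul0r.
  suff -> : l2norm (0 : H) = 0 by [].
  by have := l2normZ 0 (0 : H); rewrite scale0r normc0 mul0r.
move=> c S T; rewrite !inE/= => -[lS [M SM]] [lT [N TN]]; split.
  move=> d xi eta; rewrite -![(c *: S + T) _]/(c *: S _ + T _) lS lT.
  by rewrite !scalerDr !scalerA mulrC -!addrA; congr (_ + _); rewrite addrCA.
exists (normc c * M + N) => xi; rewrite -[(c *: S + T) _]/(c *: S _ + T _).
apply: le_trans (ler_l2normD _ _) _; rewrite l2normZ mulrDl lerD// -mulrA.
by rewrite ler_wpM2l ?normc_ge0.
Qed.

HB.instance Definition _ :=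
  GRing.isSubmodClosed.Build _ _ bounded_op bounded_op_submod_closed.

End bounded_operators.

Record Bop (R : realType) (X : choiceType) : Type := MkBop {
  Bop_fun :> ell2 R X -> ell2 R X;
  BopP : Bop_fun \in bounded_op }.
Arguments Bop : clear implicits.

Section Bop_module.
Context (R : realType) (X : choiceType).

HB.instance Definition _ := [isSub for @Bop_fun R X].
HB.instance Definition _ := [Choice of Bop R X by <:].
HB.instance Definition _ := [SubChoice_isSubLmodule of Bop R X by <:].

End Bop_module.

Section operator_norm.
Context {R : realType} {X : choiceType}.
Local Notation H := (ell2 R X).
Implicit Types (S T : Bop R X) (xi eta : H).

Lemma Bop_linear T : linear T.
Proof. by have := BopP T; rewrite inE => -[]. Qed.

HB.instance Definition _ T := GRing.isLinear.Build R[i] H H _ (T : H -> H)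
  (Bop_linear T).

Lemma BopPeq S T : (forall xi, S xi = T xi) -> S = T.
Proof. by move=> e; apply/val_inj/funext. Qed.

Definition opnorm T : R :=
  sup [set l2norm (T xi) | xi in [set xi | l2norm xi <= 1]].

Lemma l2norm0 : l2norm (0 : H) = 0.
Proof. by have := l2normZ 0 (0 : H); rewrite scale0r normc0 mul0r. Qed.

Lemma opnorm_has_sup T :
  has_sup [set l2norm (T xi) | xi in [set xi | l2norm xi <= 1]].
Proof.
have := BopP T; rewrite inE => -[_ [M TM]]; split.
  by exists (l2norm (T 0)); exists 0 => //=; rewrite l2norm0.
exists `|M| => _ [xi /= xi1 <-]; apply: le_trans (TM xi) _.
apply: (@le_trans _ _ (`|M| * l2norm xi)).
  by rewrite ler_wpM2r ?l2norm_ge0// ler_norm.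
by rewrite -[leRHS]mulr1 ler_wpM2l.
Qed.

Lemma opnorm_ub T xi : l2norm xi <= 1 -> l2norm (T xi) <= opnorm T.
Proof.
by move=> xi1; apply: ub_le_sup; [case: (opnorm_has_sup T)|exists xi].
Qed.

Lemma opnorm_le T (M : R) :
  (forall xi, l2norm xi <= 1 -> l2norm (T xi) <= M) -> opnorm T <= M.
Proof.
move=> TM; apply: ge_sup; first by case: (opnorm_has_sup T).
by move=> _ [xi /= xi1 <-]; exact: TM.
Qed.

Lemma opnorm_ge0 T : 0 <= opnorm T.
Proof.
by apply: le_trans (@opnorm_ub T 0 _); rewrite ?l2norm_ge0// l2norm0.
Qed.

Lemma l2norm_Bop_le T xi : l2norm (T xi) <= opnorm T * l2norm xi.
Proof.
have [x0|x0] := eqVneq (l2norm xi) 0.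
  by rewrite (l2norm0_eq0 x0) linear0 l2norm0 mulr0.
have {}x0 : 0 < l2norm xi by rewrite lt_neqAle eq_sym x0 l2norm_ge0.
have nx : normc ((l2norm xi)^-1)%:C = (l2norm xi)^-1.
  by rewrite /= expr0n/= addr0 sqrtr_sqr ger0_norm// invr_ge0 ltW.
have := @opnorm_ub T (((l2norm xi)^-1)%:C *: xi).
rewrite linearZ/= !l2normZ nx mulVf ?gt_eqF// => /(_ (lexx _)).
by rewrite mulrC ler_pdivrMr.
Qed.

Let norm T : R[i] := (opnorm T)%:C.

Let normD S T : norm (S + T) <= norm S + norm T.
Proof.
rewrite -rmorphD/= lecR; apply: opnorm_le => xi xi1.
apply: le_trans (ler_l2normD _ _) _.
by rewrite lerD// opnorm_ub.
Qed.

Let normZ c T : norm (c *: T) = `|c| * norm T.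
Proof.
have key d S : opnorm (d *: S) <= normc d * opnorm S.
  apply: opnorm_le => xi xi1.
  rewrite -[(d *: S) xi]/(d *: S xi) l2normZ.
  by rewrite ler_wpM2l ?normc_ge0// opnorm_ub.
suff e : opnorm (c *: T) = normc c * opnorm T by rewrite /norm e rmorphM.
apply/eqP; rewrite eq_le key/=.
have [->|c0] := eqVneq c 0; first by rewrite normc0 mul0r opnorm_ge0.
have nc0 : 0 < normc c.
  rewrite lt_neqAle normc_ge0 andbT eq_sym.
  by apply: contra c0 => /eqP/eq0_normc ->.
rewrite -ler_pdivlMl// -normcV -{1}[T](scalerK c0).
exact: key.
Qed.

Let norm0_eq0 T : norm T = 0 -> T = 0.
Proof.
move=> /complexI T0; apply: BopPeq => xi; apply: l2norm0_eq0.
apply/eqP; rewrite eq_le l2norm_ge0 andbT.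
by rewrite (le_trans (l2norm_Bop_le T xi))// T0 mul0r.
Qed.

HB.instance Definition _ := @Lmodule_isNormed.Build R[i] (Bop R X)
  norm normD normZ norm0_eq0.

Lemma Bop_normE T : `|T| = (opnorm T)%:C. Proof. by []. Qed.

End operator_norm.

Section inner_product.
Context {R : realType} {X : choiceType}.
Implicit Types (xi eta : ell2 R X).

(* The sum of an absolutely summable family, taken on positive and negative
   parts (esum is only a sum for nonnegative families). *)
Definition rsum (g : X -> R) : R :=
  fine (\esum_(x in [set: X]) (EFin \o g)^\+ x
        - \esum_(x in [set: X]) (EFin \o g)^\- x)%E.

Definition csum (g : X -> R[i]) : R[i] :=
  rsum (fun x => complex.Re (g x)) +i* rsum (fun x => complex.Im (g x)).

Definition dot xi eta : R[i] := csum (fun x => xi x * (eta x)^*).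

Lemma sqsum_supp1 (f : X -> R[i]) x :
  (forall y, y != x -> f y = 0) -> sqsum f = (normc (f x) ^+ 2)%:E.
Proof.
move=> fx; rewrite /sqsum (esumID [set x])//; last first.
  by move=> y _; rewrite lee_fin sqr_ge0.
rewrite !setTI esum_set1 ?lee_fin ?sqr_ge0// esum1 ?adde0// => y /eqP yx.
by rewrite fx// normc0 expr0n.
Qed.

Lemma delta_subproof x : (fun y : X => (y == x)%:R : R[i]) \in sqsummable.
Proof.
rewrite inE/= (@sqsum_supp1 _ x) ?ltry// => y.
by move=> /negbTE ->.
Qed.

Definition delta x : ell2 R X := Ell2 (delta_subproof x).

Let restr (A : set X) (f : X -> R[i]) : X -> R[i] :=
  fun x => if x \in A then f x else 0.

Let sqsum_restr_le A f : (sqsum (restr A f) <= sqsum f)%E.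
Proof.
apply: le_esum => x _; rewrite /restr; case: ifP => // _.
by rewrite normc0 expr0n lee_fin sqr_ge0.
Qed.

Let restr_subproof A xi : restr A xi \in sqsummable.
Proof.
rewrite inE/=; apply: le_lt_trans (sqsum_restr_le A xi) _.
by have := ell2P xi; rewrite inE.
Qed.

Definition chi_vec A xi : ell2 R X := Ell2 (restr_subproof A xi).

Lemma chi_subproof A : chi_vec A \in bounded_op.
Proof.
rewrite inE/=; split.
  move=> c xi eta; apply: ell2P_eq => x.
  rewrite -[LHS]/(restr A (c *: (xi : X -> R[i]) + eta) x).
  rewrite -[RHS]/(c * restr A xi x + restr A eta x) /restr.
  by case: ifP => //; rewrite mulr0 addr0.
exists 1 => xi; rewrite mul1r -ler_sqr ?nnegrE ?l2norm_ge0//.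
by rewrite -lee_fin !l2norm_sqr sqsum_restr_le.
Qed.

Definition chi A : Bop R X := MkBop (chi_subproof A).

End inner_product.

Section inner_product_lemmas.
Context {R : realType} {X : choiceType}.
Implicit Types (xi eta : ell2 R X).

Lemma rsum_supp1 (g : X -> R) x :
  (forall y, y != x -> g y = 0) -> rsum g = g x.
Proof.
move=> gx; rewrite /rsum.
have E (h : R -> R) : h 0 = 0 -> (forall r, 0 <= h r) ->
    (\esum_(y in [set: X]) (h (g y))%:E = (h (g x))%:E)%E.
  move=> h0 hp; rewrite (esumID [set x])//; last first.
    by move=> y _; rewrite lee_fin.
  rewrite !setTI esum_set1 ?lee_fin// esum1 ?adde0// => y /eqP yx.
  by rewrite gx// h0.
have -> : (\esum_(y in [set: X]) (EFin \o g)^\+ y = (Num.max (g x) 0)%:E)%E.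
  rewrite -(E (fun r => Num.max r 0)) ?maxxx// => [|r].
    by apply: eq_esum => y _; rewrite funeposE /= EFin_max.
  by rewrite le_max lexx orbT.
have -> : (\esum_(y in [set: X]) (EFin \o g)^\- y = (Num.max (- g x) 0)%:E)%E.
  rewrite -(E (fun r => Num.max (- r) 0)) ?oppr0 ?maxxx// => [|r].
    by apply: eq_esum => y _; rewrite funenegE /= EFin_max.
  by rewrite le_max lexx orbT.
rewrite /=; case: (leP (g x) 0) => gx0.
  by rewrite max_l ?oppr_ge0// sub0r opprK.
by rewrite max_r ?oppr_le0 ?ltW// subr0.
Qed.

Lemma dot_delta xi x : dot xi (delta x) = xi x.
Proof.
rewrite /dot /csum.
have z y : y != x -> xi y * (delta x y : R[i])^* = 0.
  by move=> /negbTE /= ->; rewrite mulr0n rmorph0 mulr0.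
rewrite !(@rsum_supp1 _ x); last 2 first.
- by move=> y /z ->.
- by move=> y /z ->.
by rewrite /= eqxx mulr1n rmorph1 mulr1; case: (xi x).
Qed.

Lemma dotxx xi : dot xi xi = (l2norm xi ^+ 2)%:C.
Proof.
have e x : xi x * (xi x)^* = (normc (xi x) ^+ 2)%:C.
  by rewrite -normCK rmorphXn.
rewrite /dot /csum /real_complex_def; congr (_ +i* _).
  rewrite /rsum (_ : (fun x => _) = fun x => normc (xi x) ^+ 2); last first.
    by apply/funext => x; rewrite e.
  rewrite [X in (_ - X)%E]esum1 => [|x _].
    rewrite sube0 -[RHS]/(fine (l2norm xi ^+ 2)%:E) l2norm_sqr; congr fine.
    apply: eq_esum => x _; rewrite funeposE /=.
    by apply/max_idPl; rewrite lee_fin sqr_ge0.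
  by rewrite funenegE /=; apply/max_idPr; rewrite lee_fin oppr_le0 sqr_ge0.
rewrite /rsum (_ : (fun x => _) = fun=> 0); last first.
  by apply/funext => x; rewrite e.
rewrite !esum1 ?sube0// => x _.
  by rewrite funenegE /= oppr0 maxxx.
by rewrite funeposE /= maxxx.
Qed.

End inner_product_lemmas.

Section metric_notions.
Context {R : realType} {X : metricType R}.
Implicit Types (A B : set X) (x y : X).

Definition uniformly_locally_finite : Prop :=
  forall r : R, 0 < r -> exists N : nat, forall x, (ball x r #<= `I_N)%card.

(* -oo when A is empty *)
Definition diam A : \bar R :=
  ereal_sup [set (mdist u.1 u.2)%:E | u in A `*` A].

(* +oo when A or B is empty *)
Definition set_dist A B : \bar R :=
  ereal_inf [set (mdist u.1 u.2)%:E | u in A `*` B].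

Definition sparse A : Prop :=
  exists F : nat -> set X,
    [/\ A = \bigcup_n F n,
        trivIset [set: nat] F,
        forall n, finite_set (F n) &
        forall r : R, exists N : nat, forall n m : nat,
          n != m -> (N <= n + m)%N -> (r%:E < set_dist (F n) (F m))%E].

End metric_notions.
Arguments uniformly_locally_finite {R} X.

Section operators.
Context {R : realType} {X : choiceType}.
Implicit Types (a p : Bop R X) (xi eta : ell2 R X).

Definition entry a x z : R[i] := dot (a (delta z)) (delta x).

Definition supp xi : set X := [set x | xi x != 0].

Definition projection p : Prop :=
  (forall xi eta, dot (p xi) eta = dot xi (p eta)) /\
  (forall xi, p (p xi) = p xi).

Definition compact_op a : Prop :=
  precompact (a @` [set xi | l2norm xi <= 1]).

Definition finite_rank a : Prop :=
  exists (n : nat) (v : 'I_n -> ell2 R X), forall xi,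
    exists c : 'I_n -> R[i], a xi = \sum_(i < n) c i *: v i.

Definition block p : Prop :=
  exists F : nat -> set X,
    [/\ trivIset [set: nat] F,
        forall n, finite_set (F n),
        forall n, F n !=set0 &
        forall xi, series (fun n => chi (F n) (p (chi (F n) xi))) @ \oo --> p xi].

Definition ghost a : Prop :=
  forall e : R, 0 < e -> exists A : set X, finite_set A /\
    forall x z, ~ A x -> ~ A z -> normc (entry a x z) <= e.

End operators.

Section roe_algebra.
Context {R : realType} {X : metricType R}.
Implicit Types (a b p : Bop R X).

Definition prop a : \bar R :=
  ereal_sup [set (mdist u.1 u.2)%:E |
             u in [set u | dot (a (delta u.1)) (delta u.2) != 0]].

Definition uniform_roe : set (Bop R X) := closure [set b | (prop b < +oo)%E].

Definition block_projection p : Prop :=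
  [/\ uniform_roe p, projection p & block p].

Definition ghost_projection p : Prop :=
  [/\ uniform_roe p, projection p & ghost p].

Definition equi_approximable (S : set (Bop R X)) : Prop :=
  forall e : R, 0 < e -> exists2 s : R, 0 < s & forall a, S a ->
    exists b : Bop R X, (prop b <= s%:E)%E /\ opnorm (a - b) <= e.

Definition ONL_finite_rank_projections : Prop :=
  forall (e : R) (S : set (Bop R X)), 0 < e ->
    S `<=` uniform_roe -> equi_approximable S ->
    (forall a, S a -> projection a /\ finite_rank a) ->
    exists2 s : R, 0 < s & forall a, S a ->
      exists xi : ell2 R X, [/\ l2norm xi = 1, (diam (supp xi) <= s%:E)%E &
        (1 - e) * opnorm a <= l2norm (a xi)].

End roe_algebra.
Arguments ONL_finite_rank_projections {R} X.

(* Main.v *)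
(* (1) => (3).  Suppose ONL fails for the equi-approximable family S: there are
   projections a in S with |a xi| < (1 - e)|a| for all unit xi supported on sets
   of arbitrarily large diameter.  Then |a delta_x| must be uniformly small:
   otherwise a delta_x, approximated by b delta_x with b of controlled
   propagation, would be a localised almost fixed vector of a.  So a is almost
   orthogonal to any prescribed finite set, and can be perturbed to a projection
   on a finite set disjoint from it.  Iterating gives disjoint blocks whose
   direct sum is a non-compact block ghost projection in the Roe algebra.

   (3) => (2).  On a sparse set a ghost projection p is, up to finitely many
   blocks, almost block diagonal, so its blocks are almost projections and can
   be rounded to an equi-approximable sequence of finite-rank projections q_n.
   Since |p delta_x|^2 = p_xx tends to 0, vectors of bounded support diameter
   are almost annihilated by q_n, and ONL forces q_n = 0 for large n.  Hence p is
   within norm 1/2 of its compression to a finite set, so its range embeds in a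
   finite-dimensional space.

   (2) => (1).  Among the infinitely many non-zero blocks of a non-compact block
   projection choose a subsequence with pairwise distances tending to infinity;
   it lives on a sparse subset. *)

Require Import Defs.
From mathcomp Require Import all_boot all_order all_algebra.
From mathcomp Require Import all_classical all_reals all_analysis.
From mathcomp Require Import complex ring lra.

Set Implicit Arguments.
Unset Strict Implicit.
Unset Printing Implicit Defensive.

Import Order.TTheory GRing.Theory Num.Theory.
Import numFieldNormedType.Exports.
Import Normc.

Local Open Scope classical_set_scope.
Local Open Scope ring_scope.
Local Open Scope complex_scope.

(** * Absolutely summable families *)

Section real_sums.
Context {R : realType} {X : choiceType}.
Implicit Types f g u v : X -> R.

Definition rsummable f : Prop := summable [set: X] (EFin \o f).

(** [rsum] is built from positive and negative parts, which are not additive. Here any splitting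
    into non-negative summable families computes it, and linearity follows from a suitable choice of
    splitting. *)
Lemma rsum_sub u v : (forall x, 0 <= u x) -> (forall x, 0 <= v x) ->
  rsummable u -> rsummable v ->
  rsum (fun x => u x - v x) =
  fine (\esum_(x in [set: X]) (u x)%:E) - fine (\esum_(x in [set: X]) (v x)%:E).
Proof.
move=> u0 v0 su sv; rewrite /rsum.
have fin w : (forall x, 0 <= w x) -> rsummable w ->
    (\esum_(x in [set: X]) (w x)%:E)%E \is a fin_num.
  move=> w0; rewrite /rsummable summableE.
  by under eq_esum do rewrite /= ger0_norm//.
have -> : EFin \o (fun x => u x - v x) = ((EFin \o u) \- (EFin \o v))%E.
  by apply/funext => x.
rewrite esumB//; last 2 first.
- by move=> x _; rewrite lee_fin.
- by move=> x _; rewrite lee_fin.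
by rewrite fineB// fin.
Qed.

Lemma rsummable_le f g : rsummable g -> (forall x, `|f x| <= `|g x|) ->
  rsummable f.
Proof.
move=> sg fg; apply: le_lt_trans sg; apply: le_esum => x _.
by rewrite /= lee_fin.
Qed.

Lemma rsummableD f g : rsummable f -> rsummable g ->
  rsummable (fun x => f x + g x).
Proof. exact: summableD. Qed.

Lemma rsummableZ k f : rsummable f -> rsummable (fun x => k * f x).
Proof.
rewrite /rsummable /summable /= => sf.
under eq_esum do rewrite normrM.
by rewrite esumZl// lte_mul_pinfty// lee_fin.
Qed.

Lemma fine_esumD u v : (forall x, 0 <= u x) -> (forall x, 0 <= v x) ->
  rsummable u -> rsummable v ->
  fine (\esum_(x in [set: X]) (u x + v x)%:E) =
  fine (\esum_(x in [set: X]) (u x)%:E) + fine (\esum_(x in [set: X]) (v x)%:E).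
Proof.
move=> u0 v0 su sv.
have fin w : (forall x, 0 <= w x) -> rsummable w ->
    (\esum_(x in [set: X]) (w x)%:E)%E \is a fin_num.
  move=> w0; rewrite /rsummable summableE.
  by under eq_esum do rewrite /= ger0_norm//.
rewrite -fineD ?fin// -esumD// => x _; by rewrite lee_fin.
Qed.

Let pos f x := Num.max (f x) 0.
Let neg f x := Num.max (- f x) 0.

Let pos_ge0 f x : 0 <= pos f x. Proof. by rewrite le_max lexx orbT. Qed.
Let neg_ge0 f x : 0 <= neg f x. Proof. by rewrite le_max lexx orbT. Qed.

Let posneg f x : f x = pos f x - neg f x.
Proof.
rewrite /pos /neg; case: (leP 0 (f x)) => f0.
  by rewrite max_r ?subr0// oppr_le0.
by rewrite max_l ?opprK ?add0r// oppr_ge0 ltW.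
Qed.

Let pos_summable f : rsummable f -> rsummable (pos f).
Proof.
move=> sf; apply: rsummable_le sf _ => x; rewrite ger0_norm// /pos.
by rewrite ge_max ler_norm normr_ge0.
Qed.

Let neg_summable f : rsummable f -> rsummable (neg f).
Proof.
move=> sf; apply: rsummable_le sf _ => x; rewrite ger0_norm// /neg.
by rewrite ge_max -normrN ler_norm normr_ge0.
Qed.

Lemma rsumD f g : rsummable f -> rsummable g ->
  rsum (fun x => f x + g x) = rsum f + rsum g.
Proof.
move=> sf sg.
(* This splitting is in general not the one into positive and negative parts of the sum, but
   [rsum_sub] accepts it. *)
have -> : (fun x => f x + g x) =
    (fun x => (pos f x + pos g x) - (neg f x + neg g x)).
  by apply/funext => x; rewrite {1}posneg {1}(posneg g); ring.
have E h : rsummable h -> rsum h =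
    fine (\esum_(x in [set: X]) (pos h x)%:E)
    - fine (\esum_(x in [set: X]) (neg h x)%:E).
  move=> sh; rewrite -rsum_sub//; last 2 first.
  - exact: pos_summable.
  - exact: neg_summable.
  by congr rsum; apply/funext => x; rewrite -posneg.
have [pf pg nf ng] := And4 (pos_summable sf) (pos_summable sg)
  (neg_summable sf) (neg_summable sg).
rewrite rsum_sub; last 4 first.
- by move=> x; rewrite addr_ge0.
- by move=> x; rewrite addr_ge0.
- exact: rsummableD.
- exact: rsummableD.
rewrite (fine_esumD (pos_ge0 f) (pos_ge0 g) pf pg).
rewrite (fine_esumD (neg_ge0 f) (neg_ge0 g) nf ng) (E _ sf) (E _ sg).
by rewrite opprD addrACA.
Qed.

Lemma rsumN f : rsum (fun x => - f x) = - rsum f.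
Proof.
rewrite /rsum.
have -> : (EFin \o (fun x => (- f x)%R))^\+%E = (EFin \o f)^\-%E.
  by apply/funext => x; rewrite funeposE funenegE.
have -> : (EFin \o (fun x => (- f x)%R))^\-%E = (EFin \o f)^\+%E.
  by apply/funext => x; rewrite funeposE funenegE /= opprK.
set a := (\esum_(x in _) _)%E; set b := (\esum_(x in _) _)%E.
by case: a b => [a||] [b||]//=; rewrite ?oppr0// opprB.
Qed.

Lemma rsumZ k f : rsummable f -> rsum (fun x => k * f x) = k * rsum f.
Proof.
have pk l g : 0 <= l -> rsummable g -> rsum (fun x => l * g x) = l * rsum g.
  move=> l0 sg.
  have -> : (fun x => l * g x) = (fun x => l * pos g x - l * neg g x).
    by apply/funext => x; rewrite {1}posneg mulrBr.
  rewrite rsum_sub; last 4 first.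
  - by move=> x; rewrite mulr_ge0.
  - by move=> x; rewrite mulr_ge0.
  - exact/rsummableZ/pos_summable.
  - exact/rsummableZ/neg_summable.
  rewrite !esumZl//.
  (* Also true for infinite [w]: [fine] sends both infinities to 0, and so both sides vanish. *)
  have fM (w : \bar R) : fine (l%:E * w) = l * fine w.
    case: w => [w||]//=.
      rewrite mulry; have [->|n0] := eqVneq l 0; first by rewrite sgr0 mul0e mul0r.
      by rewrite gtr0_sg ?lt_neqAle 1?eq_sym ?n0// mul1e mulr0.
    rewrite mulrNy; have [->|n0] := eqVneq l 0; first by rewrite sgr0 mul0e mul0r.
    by rewrite gtr0_sg ?lt_neqAle 1?eq_sym ?n0// mul1e mulr0.
  rewrite !fM -mulrBr; congr (_ * _).
  rewrite -rsum_sub//; last 2 first.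
  - exact: pos_summable.
  - exact: neg_summable.
  by congr rsum; apply/funext => x; rewrite -posneg.
move=> sf; case: (leP 0 k) => k0; first exact: pk.
have -> : (fun x => k * f x) = (fun x => - (- k * f x)).
  by apply/funext => x; rewrite mulNr opprK.
by rewrite rsumN pk ?oppr_ge0 ?ltW// mulNr opprK.
Qed.

End real_sums.

Lemma complexD {R : rcfType} (a b c d : R) :
  (a +i* b) + (c +i* d) = (a + c) +i* (b + d).
Proof. by []. Qed.

Lemma complexM {R : rcfType} (a b c d : R) :
  (a +i* b) * (c +i* d) = (a * c - b * d) +i* (a * d + b * c).
Proof. by []. Qed.

Lemma Re_abs_le_normc {R : rcfType} (z : R[i]) : `|complex.Re z| <= normc z.
Proof. by case: z => a b /=; rewrite -sqrtr_sqr ler_wsqrtr// lerDl sqr_ge0. Qed.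

Lemma Im_abs_le_normc {R : rcfType} (z : R[i]) : `|complex.Im z| <= normc z.
Proof. by case: z => a b /=; rewrite -sqrtr_sqr ler_wsqrtr// lerDr sqr_ge0. Qed.

(** * Linearity of absolutely convergent complex sums, by real and imaginary parts *)

Section complex_sums.
Context {R : realType} {X : choiceType}.
Implicit Types f g : X -> R[i].

Definition csummable f : Prop := rsummable (fun x => normc (f x)).

Lemma csummable_Re f : csummable f -> rsummable (fun x => complex.Re (f x)).
Proof.
move=> sf; apply: rsummable_le sf _ => x.
by rewrite [leRHS]ger0_norm ?normc_ge0// Re_abs_le_normc.
Qed.

Lemma csummable_Im f : csummable f -> rsummable (fun x => complex.Im (f x)).
Proof.
move=> sf; apply: rsummable_le sf _ => x.
by rewrite [leRHS]ger0_norm ?normc_ge0// Im_abs_le_normc.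
Qed.

Lemma csumD f g : csummable f -> csummable g ->
  csum (fun x => f x + g x) = csum f + csum g.
Proof.
move=> sf sg; rewrite /csum.
have [fR gR fI gI] := And4 (csummable_Re sf) (csummable_Re sg)
  (csummable_Im sf) (csummable_Im sg).
rewrite [RHS]complexD -!rsumD//; congr (_ +i* _); congr rsum;
  by apply/funext => x; case: (f x) (g x) => [? ?] [].
Qed.

Lemma csumZ c f : csummable f -> csum (fun x => c * f x) = c * csum f.
Proof.
move=> sf; case: c => a b; rewrite /csum.
have [fR fI] := conj (csummable_Re sf) (csummable_Im sf).
have bI : rsummable (fun x => - (b * complex.Im (f x))).
  by apply: rsummable_le (rsummableZ b fI) _ => x; rewrite normrN.
rewrite [RHS]complexM -(rsumZ a fR) -(rsumZ b fI) -(rsumZ a fI) -(rsumZ b fR).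
rewrite -rsumN -(rsumD (rsummableZ a fR) bI).
rewrite -(rsumD (rsummableZ a fI) (rsummableZ b fR)).
by congr (_ +i* _); congr rsum; apply/funext => x; case: (f x).
Qed.

Lemma csum_conj f : csum (fun x => (f x)^*) = (csum f)^*.
Proof.
rewrite /csum [RHS]/= -rsumN; congr (_ +i* _); congr rsum;
  by apply/funext => x; case: (f x).
Qed.

End complex_sums.

(** * The Hilbert space of square-summable families *)

Section conjugation.
Context {R : rcfType}.
Implicit Types (z : R[i]) (r : R).

Lemma normc_conj z : normc (Num.conj z) = normc z.
Proof. by case: z => a b /=; rewrite sqrrN. Qed.

Lemma mul_conjE z : z * Num.conj z = (normc z ^+ 2)%:C.
Proof. by rewrite -normCK rmorphXn. Qed.

Lemma conj_realE r : Num.conj (r%:C : R[i]) = r%:C.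
Proof. by rewrite /real_complex_def /=; congr (_ +i* _); rewrite oppr0. Qed.

Lemma normc_real r : normc (r%:C : R[i]) = `|r|.
Proof. by rewrite /= expr0n/= addr0 sqrtr_sqr. Qed.

Lemma realCD (r s : R) : ((r + s)%:C : R[i]) = r%:C + s%:C.
Proof. exact: rmorphD. Qed.

Lemma realCB (r s : R) : ((r - s)%:C : R[i]) = r%:C - s%:C.
Proof. exact: rmorphB. Qed.

Lemma realCM (r s : R) : ((r * s)%:C : R[i]) = r%:C * s%:C.
Proof. exact: rmorphM. Qed.

Lemma Re_le_normc z : complex.Re z <= normc z.
Proof. exact: le_trans (ler_norm _) (Re_abs_le_normc z). Qed.

End conjugation.

(** * Sesquilinearity, Cauchy-Schwarz and orthogonality *)

Section dot_theory.
Context {R : realType} {X : choiceType}.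
Implicit Types (xi eta zeta : ell2 R X) (c : R[i]).

Lemma rsummable_sqsum xi : rsummable (fun x => normc (xi x) ^+ 2).
Proof.
have := ell2P xi; rewrite inE; apply: le_lt_trans; apply: le_esum => x _.
by rewrite /= ger0_norm// sqr_ge0.
Qed.

Lemma csummable_dot xi eta : csummable (fun x => xi x * Num.conj (eta x)).
Proof.
apply: (rsummable_le (rsummableD (rsummable_sqsum xi) (rsummable_sqsum eta))) => x.
rewrite ger0_norm ?normc_ge0// ger0_norm ?addr_ge0 ?sqr_ge0//.
rewrite normcM normc_conj.
have := normc_ge0 (xi x); have := normc_ge0 (eta x).
move: (normc _) (normc _) => a b a0 b0; nra.
Qed.

Lemma dotDl xi eta zeta : dot (xi + eta) zeta = dot xi zeta + dot eta zeta.
Proof.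
rewrite /dot -csumD; [|exact: csummable_dot..].
by congr csum; apply/funext => x; rewrite -mulrDl.
Qed.

Lemma dotZl c xi eta : dot (c *: xi) eta = c * dot xi eta.
Proof.
rewrite /dot -csumZ; last exact: csummable_dot.
by congr csum; apply/funext => x; rewrite mulrA.
Qed.

Lemma dotC xi eta : dot eta xi = Num.conj (dot xi eta).
Proof.
rewrite /dot -[RHS]csum_conj.
congr csum; apply/funext => x.
by rewrite -[RHS]/(Num.conj _) rmorphM/= conjCK mulrC.
Qed.

Lemma dotDr xi eta zeta : dot xi (eta + zeta) = dot xi eta + dot xi zeta.
Proof. by rewrite dotC dotDl rmorphD/= -!dotC. Qed.

Lemma dotZr c xi eta : dot xi (c *: eta) = Num.conj c * dot xi eta.
Proof. by rewrite dotC dotZl rmorphM/= -dotC. Qed.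

Lemma dot0l xi : dot 0 xi = 0.
Proof. by rewrite -(scale0r (0 : ell2 R X)) dotZl mul0r. Qed.

Lemma dot0r xi : dot xi 0 = 0.
Proof. by rewrite dotC dot0l rmorph0. Qed.

Lemma dotNl xi eta : dot (- xi) eta = - dot xi eta.
Proof. by rewrite -scaleN1r dotZl mulN1r. Qed.

Lemma dotNr xi eta : dot xi (- eta) = - dot xi eta.
Proof. by rewrite dotC dotNl rmorphN/= -dotC. Qed.

Lemma dotBl xi eta zeta : dot (xi - eta) zeta = dot xi zeta - dot eta zeta.
Proof. by rewrite dotDl dotNl. Qed.

Lemma dotBr xi eta zeta : dot xi (eta - zeta) = dot xi eta - dot xi zeta.
Proof. by rewrite dotDr dotNr. Qed.

Lemma dot_suml I (r : seq I) (P : pred I) (F : I -> ell2 R X) xi :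
  dot (\sum_(i <- r | P i) F i) xi = \sum_(i <- r | P i) dot (F i) xi.
Proof.
by elim/big_rec2: _ => [|i a b _ <-]; [exact: dot0l|rewrite dotDl].
Qed.

Lemma dot_sumr I (r : seq I) (P : pred I) (F : I -> ell2 R X) xi :
  dot xi (\sum_(i <- r | P i) F i) = \sum_(i <- r | P i) dot xi (F i).
Proof.
by elim/big_rec2: _ => [|i a b _ <-]; [exact: dot0r|rewrite dotDr].
Qed.

Lemma normc_dot_le xi eta : normc (dot xi eta) <= l2norm xi * l2norm eta.
Proof.
have [e0|e0] := eqVneq (l2norm eta) 0.
  by rewrite (l2norm0_eq0 e0) dot0r normc0 l2norm0 mulr0.
have {}e0 : 0 < l2norm eta by rewrite lt_neqAle eq_sym e0 l2norm_ge0.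
pose n := l2norm eta ^+ 2; pose D := dot xi eta.
have n0 : 0 < n by rewrite exprn_gt0.
(* Cauchy-Schwarz: the squared norm of [n *: xi - D *: eta] is non-negative, and with [n] the
   squared norm of [eta] no division is required. *)
have : dot (n%:C *: xi - D *: eta) (n%:C *: xi - D *: eta)
     = (n * (n * l2norm xi ^+ 2 - normc D ^+ 2))%:C.
  rewrite !(dotBl, dotBr, dotZl, dotZr) !dotxx conj_realE.
  rewrite -[dot eta xi]/(dot eta xi) (dotC xi eta) -/D -/n.
  have e := mul_conjE D.
  rewrite (realCM n (_ - _)) realCB (realCM n) -e.
  clear e; move: D (n%:C) ((_ ^+ 2)%:C) (Num.conj D) => d a b c; ring.
rewrite dotxx => /complexI h.
have : 0 <= n * (n * l2norm xi ^+ 2 - normc D ^+ 2) by rewrite -h sqr_ge0.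
rewrite pmulr_rge0// subr_ge0 -/D => h2.
rewrite -ler_sqr ?nnegrE ?normc_ge0 ?mulr_ge0 ?l2norm_ge0//.
by rewrite exprMn mulrC.
Qed.

Lemma l2normN xi : l2norm (- xi) = l2norm xi.
Proof. by rewrite -scaleN1r l2normZ normcN normc1 mul1r. Qed.

Lemma l2normBC xi eta : l2norm (xi - eta) = l2norm (eta - xi).
Proof. by rewrite -l2normN opprB. Qed.

Lemma ler_l2dist zeta xi eta :
  l2norm (xi - eta) <= l2norm (xi - zeta) + l2norm (zeta - eta).
Proof. by rewrite -[xi - eta](subrKA zeta) ler_l2normD. Qed.

Lemma ler_l2norm_sub xi eta : l2norm xi - l2norm eta <= l2norm (xi - eta).
Proof. by rewrite lerBlDr -{1}[xi](subrK eta) ler_l2normD. Qed.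

Lemma ler_l2norm_sum I (r : seq I) (P : pred I) (F : I -> ell2 R X) :
  l2norm (\sum_(i <- r | P i) F i) <= \sum_(i <- r | P i) l2norm (F i).
Proof.
elim/big_rec2: _ => [|i a b _ h]; first by rewrite l2norm0.
by apply: le_trans (ler_l2normD _ _) _; rewrite lerD2l.
Qed.

Lemma l2norm_sqrE xi : l2norm xi ^+ 2 = complex.Re (dot xi xi).
Proof. by rewrite dotxx. Qed.

Lemma pythagoras xi eta : dot xi eta = 0 ->
  l2norm (xi + eta) ^+ 2 = l2norm xi ^+ 2 + l2norm eta ^+ 2.
Proof.
move=> o; apply: complexI; rewrite realCD -!dotxx dotDl !dotDr o.
by rewrite (dotC xi eta) o rmorph0 addr0 add0r.
Qed.

Lemma pythagoras_sum n (F : 'I_n -> ell2 R X) :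
  (forall i j, i != j -> dot (F i) (F j) = 0) ->
  l2norm (\sum_i F i) ^+ 2 = \sum_i l2norm (F i) ^+ 2.
Proof.
move=> o; apply: complexI; rewrite rmorph_sum/= -dotxx dot_suml.
apply: eq_bigr => i _; rewrite dot_sumr (bigD1 i)//= big1 ?addr0 ?dotxx// => j ji.
by rewrite o// eq_sym.
Qed.

Lemma dot_disjoint xi eta : (forall x, xi x = 0 \/ eta x = 0) -> dot xi eta = 0.
Proof.
(* The zero family is written as [0 * 0] so that homogeneity of [csum] evaluates its sum. *)
move=> h; rewrite /dot (_ : (fun x => _) = fun=> 0 * 0); last first.
  by apply/funext => x; case: (h x) => ->; rewrite ?rmorph0 ?mul0r ?mulr0.
rewrite csumZ ?mul0r// /csummable /rsummable /summable esum1 ?ltry// => x _.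
by rewrite -[LHS]/(`|(normc 0)%:E|%E) normc0 abse0.
Qed.

Lemma l2norm_delta x : l2norm (delta x : ell2 R X) = 1.
Proof.
apply/eqP; rewrite -(@eqrXn2 _ 2)// ?l2norm_ge0//.
rewrite l2norm_sqrE dot_delta/= eqxx expr1n; exact/eqP.
Qed.

Lemma l2norm_le_abs xi eta : (forall x, normc (xi x) <= normc (eta x)) ->
  l2norm xi <= l2norm eta.
Proof.
move=> h; rewrite -ler_sqr ?nnegrE ?l2norm_ge0// -lee_fin !l2norm_sqr.
by apply: le_esum => x _; rewrite lee_fin ler_sqr ?nnegrE ?normc_ge0.
Qed.

Lemma ell2D xi eta x : (xi + eta) x = xi x + eta x. Proof. by []. Qed.
Lemma ell2B xi eta x : (xi - eta) x = xi x - eta x. Proof. by []. Qed.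
Lemma ell2Z c xi x : (c *: xi) x = c * xi x. Proof. by []. Qed.
Lemma ell2_sum I (r : seq I) (P : pred I) (F : I -> ell2 R X) x :
  (\sum_(i <- r | P i) F i) x = \sum_(i <- r | P i) F i x.
Proof. by elim/big_rec2: _ => // i a b _ <-. Qed.
Lemma deltaE x y : (delta x : ell2 R X) y = (y == x)%:R. Proof. by []. Qed.

End dot_theory.

(** * Coordinate projections and tails of vectors *)

Section restriction.
Context {R : realType} {X : choiceType}.
Implicit Types (xi eta : ell2 R X) (A B : set X).

Lemma chiE A xi x : chi A xi x = if x \in A then xi x else 0.
Proof. by []. Qed.

Lemma chi_in A xi x : A x -> chi A xi x = xi x.
Proof. by move=> Ax; rewrite chiE mem_set. Qed.

Lemma chi_out A xi x : ~ A x -> chi A xi x = 0.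
Proof. by move=> Ax; rewrite chiE memNset. Qed.

Lemma chi_id A xi : (forall x, ~ A x -> xi x = 0) -> chi A xi = xi.
Proof.
move=> h; apply: ell2P_eq => x; rewrite chiE.
by case: ifPn => // /negP; rewrite in_setE => /h.
Qed.

Lemma chi_eq0 A xi : (forall x, A x -> xi x = 0) -> chi A xi = 0.
Proof.
move=> h; apply: ell2P_eq => x; rewrite chiE.
by case: ifPn => //; rewrite in_setE => /h.
Qed.

Lemma chiI A B xi : chi A (chi B xi) = chi (A `&` B) xi.
Proof. by apply: ell2P_eq => x; rewrite !chiE in_setI; case: (x \in A). Qed.

Lemma chi_idem A xi : chi A (chi A xi) = chi A xi.
Proof. by rewrite chiI setIid. Qed.

Lemma chi_le A xi : l2norm (chi A xi) <= l2norm xi.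
Proof.
apply: l2norm_le_abs => x; rewrite chiE; case: ifP => //.
by rewrite normc0 normc_ge0.
Qed.

Lemma chi_compl A xi : xi = chi A xi + chi (~` A) xi.
Proof.
apply: ell2P_eq => x; rewrite ell2D !chiE in_setC.
by case: (x \in A); rewrite ?addr0 ?add0r.
Qed.

Lemma chi_complB A xi : xi - chi A xi = chi (~` A) xi.
Proof. by rewrite {1}(chi_compl A xi) addrC addKr. Qed.

Lemma chi_self A xi eta : dot (chi A xi) eta = dot xi (chi A eta).
Proof.
rewrite {2}(chi_compl A xi) {1}(chi_compl A eta) dotDl dotDr.
rewrite [dot _ (chi (~` A) _)]dot_disjoint ?[dot (chi (~` A) _) _]dot_disjoint//.
- by move=> x; case: (pselect (A x)) => Ax; [left|right]; apply: chi_out.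
- by move=> x; case: (pselect (A x)) => Ax; [right|left]; apply: chi_out.
Qed.

Lemma l2norm_split A xi :
  l2norm xi ^+ 2 = l2norm (chi A xi) ^+ 2 + l2norm (chi (~` A) xi) ^+ 2.
Proof.
rewrite {1}(chi_compl A xi) pythagoras//; apply: dot_disjoint => x.
by case: (pselect (A x)) => Ax; [right|left]; apply: chi_out.
Qed.

Lemma chi_delta A x : chi A (delta x : ell2 R X) = if x \in A then delta x else 0.
Proof.
case: ifPn => [|/negP]; rewrite in_setE => Ax.
  by apply: chi_id => y Ay; rewrite deltaE; case: eqP => // yx; rewrite yx in Ay.
by apply: chi_eq0 => y Ay; rewrite deltaE; case: eqP => // yx; rewrite -yx in Ax.
Qed.

Lemma chi_finE (s : seq X) xi : uniq s ->
  chi [set` s] xi = \sum_(x <- s) xi x *: delta x.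
Proof.
move=> us; apply: ell2P_eq => x; rewrite ell2_sum chiE.
under eq_bigr => y _ do rewrite ell2Z deltaE.
case: ifPn => [|/negP]; rewrite in_setE/= => xs.
  rewrite (big_rem x)//= eqxx mulr1 big_seq big1 ?addr0// => y.
  rewrite mem_rem_uniq// inE => /andP[yx _].
  by rewrite eq_sym (negbTE yx) mulr0.
rewrite big_seq big1// => y ys; case: eqP => [xy|_]; last by rewrite mulr0.
by rewrite xy in xs.
Qed.

Lemma finite_set_uniq_seq A : finite_set A -> exists2 s : seq X, uniq s & A = [set` s].
Proof.
move=> /finite_seqP[s ->]; exists (undup s); first exact: undup_uniq.
by apply/seteqP; split => x /=; rewrite mem_undup.
Qed.

(** A finite partial sum within [e ^+ 2] of the supremum [sqsum xi] leaves squared norm at most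
    [e ^+ 2] outside [A], and less outside any larger [B]. *)
Lemma tail_small xi (e : R) : 0 < e -> exists A : set X, finite_set A /\
  forall B, A `<=` B -> l2norm (chi (~` B) xi) <= e.
Proof.
move=> e0.
have fin := sqsum_fin (ell2P xi).
have e2 : 0 < e ^+ 2 by rewrite exprn_gt0.
have : (sqsum xi - (e ^+ 2)%:E < sqsum xi)%E.
  by rewrite lteBlDr// lteDl// lte_fin.
rewrite {2}/sqsum => /ereal_sup_gt[_ [A [fA _] <-]] hA.
exists A; split => // B AB.
rewrite -ler_sqr ?nnegrE ?l2norm_ge0 ?(ltW e0)//.
have hB : (\sum_(x \in A) (normc (xi x) ^+ 2)%:E <= (l2norm (chi B xi) ^+ 2)%:E)%E.
  rewrite l2norm_sqr; apply: esum_ge; exists A => //.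
  apply: lee_fsum => // x Ax; rewrite (chi_in _ (AB _ Ax))//.
have := lt_le_trans hA hB.
rewrite -(l2norm_sqr xi) (l2norm_split B xi) -EFinB lte_fin.
by rewrite -addrA gtrDl subr_lt0 => /ltW.
Qed.

End restriction.

(** * Bounded operators and projections *)

Section norm_topology.
Context {R : realType}.

(** Radii of balls in a normed module over [R[i]] are complex. Positivity in the order of [R[i]]
    makes them real, which reduces all topological statements to real epsilons. *)
Lemma posC (z : R[i]) : 0 < z -> exists2 r : R, 0 < r & z = r%:C.
Proof.
case: z => a b; rewrite ltcE /= => /andP[/eqP -> a0].
by exists a.
Qed.

Context {X : choiceType}.
Implicit Types (xi eta : ell2 R X) (T : Bop R X).

Lemma ball_ell2 xi eta (r : R) :
  ball xi (r%:C : R[i]) eta = (l2norm (xi - eta) < r) :> Prop.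
Proof. by rewrite -ball_normE /= ell2_normE ltcR. Qed.

Lemma ball_Bop (S T : Bop R X) (r : R) :
  ball S (r%:C : R[i]) T = (opnorm (S - T) < r) :> Prop.
Proof. by rewrite -ball_normE /= Bop_normE ltcR. Qed.

Lemma cvg_l2P (u : nat -> ell2 R X) xi : u @ \oo --> xi <->
  forall e : R, 0 < e -> exists N, forall n, (N <= n)%N -> l2norm (xi - u n) <= e.
Proof.
split=> [/cvgrPdist_le h e e0|h].
  have e0' : 0 < (e%:C : R[i]) by rewrite ltcR.
  have [N _ NP] := h _ e0'; exists N => n /NP.
  by rewrite /= ell2_normE lecR.
apply/cvgrPdist_le => _ /posC[e e0 ->].
have [N NP] := h _ e0; exists N => // n /NP.
by rewrite /= ell2_normE lecR.
Qed.

Lemma closure_BopP (A : set (Bop R X)) T : closure A T <->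
  forall e : R, 0 < e -> exists2 b, A b & opnorm (T - b) <= e.
Proof.
split=> [h e e0|h U /nbhs_ballP[_ /posC[e e0 ->]] TU].
  have [|b [Ab]] := h (ball T (e%:C : R[i])).
    by apply: nbhsx_ballx; rewrite ltcR.
  by rewrite ball_Bop => /ltW; exists b.
have [|b Ab be] := h (e / 2); first by rewrite divr_gt0.
exists b; split => //; apply: TU; rewrite ball_Bop.
by apply: le_lt_trans be _; rewrite ltr_pdivrMr// ltr_pMr// ltr1n.
Qed.

End norm_topology.

Section operators_basics.
Context {R : realType} {X : choiceType}.
Local Notation H := (ell2 R X).
Implicit Types (xi eta : H) (S T : Bop R X) (A B : set X).

Lemma BopB S T xi : (S - T) xi = S xi - T xi. Proof. by []. Qed.
Lemma BopvZ T c xi : T (c *: xi) = c *: T xi. Proof. exact: linearZ. Qed.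
Lemma BopvB T xi eta : T (xi - eta) = T xi - T eta. Proof. exact: linearB. Qed.
Lemma BopvD T xi eta : T (xi + eta) = T xi + T eta. Proof. exact: linearD. Qed.
Lemma Bopv_sum T I (r : seq I) (P : pred I) (F : I -> H) :
  T (\sum_(i <- r | P i) F i) = \sum_(i <- r | P i) T (F i).
Proof. exact: linear_sum. Qed.
Lemma Bop0 xi : (0 : Bop R X) xi = 0. Proof. by []. Qed.
Lemma Bop_sum I (r : seq I) (P : pred I) (F : I -> Bop R X) xi :
  (\sum_(i <- r | P i) F i) xi = \sum_(i <- r | P i) F i xi.
Proof. by elim/big_rec2: _ => // i a b _ <-. Qed.

Lemma opnorm_le_bound T (M : R) : 0 <= M ->
  (forall xi, l2norm (T xi) <= M * l2norm xi) -> opnorm T <= M.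
Proof.
move=> M0 h; apply: opnorm_le => xi xi1; apply: le_trans (h xi) _.
by rewrite -[leRHS]mulr1 ler_wpM2l.
Qed.

Lemma l2norm_Bop_bound T (M : R) xi : opnorm T <= M ->
  l2norm (T xi) <= M * l2norm xi.
Proof.
by move=> h; apply: le_trans (l2norm_Bop_le _ _) _; rewrite ler_wpM2r ?l2norm_ge0.
Qed.

Lemma mkBop_subproof (f : H -> H) :
  linear f -> (exists M : R, forall xi, l2norm (f xi) <= M * l2norm xi) ->
  f \in bounded_op.
Proof. by move=> lf bf; rewrite inE. Qed.

Lemma compB_subproof S T : (fun xi => S (T xi)) \in bounded_op.
Proof.
apply: mkBop_subproof => [c xi eta|]; first by rewrite !linearP.
exists (opnorm S * opnorm T) => xi; apply: le_trans (l2norm_Bop_le _ _) _.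
by rewrite -mulrA ler_wpM2l ?opnorm_ge0// l2norm_Bop_le.
Qed.

Definition compB S T : Bop R X := MkBop (compB_subproof S T).

Lemma compBE S T xi : compB S T xi = S (T xi). Proof. by []. Qed.

Lemma rank1_subproof xi eta : (fun zeta : H => dot zeta eta *: xi) \in bounded_op.
Proof.
apply: mkBop_subproof => [c a b|].
  by rewrite dotDl dotZl scalerDl scalerA.
exists (l2norm eta * l2norm xi) => a; rewrite l2normZ mulrAC ler_wpM2r ?l2norm_ge0//.
by rewrite [leRHS]mulrC normc_dot_le.
Qed.

Definition rank1 xi eta : Bop R X := MkBop (rank1_subproof xi eta).

(** Mutually adjoint maps have the same bound: the square of [l2norm (f xi)] is the inner product of
    [xi] with [g (f xi)]. It serves to turn estimates for [chi A] after an operator into estimates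
    for [chi A] before it. *)
Lemma adjoint_bound (f g : H -> H) (M : R) :
  (forall xi eta, dot (f xi) eta = dot xi (g eta)) ->
  (forall eta, l2norm (g eta) <= M * l2norm eta) ->
  forall xi, l2norm (f xi) <= M * l2norm xi.
Proof.
move=> fg gM xi.
have [f0|f0] := eqVneq (l2norm (f xi)) 0.
  rewrite f0; have [x0|x0] := eqVneq (l2norm xi) 0; first by rewrite x0 mulr0.
  rewrite mulr_ge0 ?l2norm_ge0//.
  have : 0 <= M * l2norm xi by apply: le_trans (gM xi); exact: l2norm_ge0.
  by rewrite pmulr_lge0// lt_neqAle eq_sym x0 l2norm_ge0.
have {}f0 : 0 < l2norm (f xi) by rewrite lt_neqAle eq_sym f0 l2norm_ge0.
rewrite -(ler_pM2l f0) -expr2 l2norm_sqrE fg.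
apply: le_trans (Re_le_normc _) _; apply: le_trans (normc_dot_le _ _) _.
rewrite mulrA [leRHS]mulrC; apply: ler_wpM2l; first exact: l2norm_ge0.
by rewrite [leRHS]mulrC; exact: gM.
Qed.

Lemma entryE T x z : entry T x z = T (delta z) x.
Proof. exact: dot_delta. Qed.

Lemma unit_normalize xi : xi != 0 -> exists2 r : R, 0 < r & l2norm (r%:C *: xi) = 1.
Proof.
move=> x0; have n0 : 0 < l2norm xi.
  rewrite lt_neqAle l2norm_ge0 andbT eq_sym; apply: contra_neq x0.
  exact: l2norm0_eq0.
exists (l2norm xi)^-1; first by rewrite invr_gt0.
by rewrite l2normZ normc_real gtr0_norm ?invr_gt0// mulVf// gt_eqF.
Qed.

Section projections.
Context (p : Bop R X) (pp : projection p).

Lemma projection_self xi eta : dot (p xi) eta = dot xi (p eta).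
Proof. by case: pp => h _; exact: h. Qed.

Lemma projection_idem xi : p (p xi) = p xi.
Proof. by case: pp => _; exact. Qed.

Lemma projection_dot xi : dot (p xi) xi = (l2norm (p xi) ^+ 2)%:C.
Proof. by rewrite -dotxx -projection_self projection_idem. Qed.

Lemma projection_le xi : l2norm (p xi) <= l2norm xi.
Proof.
have [->|p0] := eqVneq (l2norm (p xi)) 0; first exact: l2norm_ge0.
have {}p0 : 0 < l2norm (p xi) by rewrite lt_neqAle eq_sym p0 l2norm_ge0.
rewrite -(ler_pM2l p0) -expr2 -[leLHS]ger0_norm ?sqr_ge0// -normc_real.
by rewrite -projection_dot normc_dot_le.
Qed.

Lemma projection_opnorm_le1 : opnorm p <= 1.
Proof. by apply: opnorm_le_bound => // xi; rewrite mul1r projection_le. Qed.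

(** Applied to the fixed vector [p xi], the bound says that its norm is at most [c] times itself. *)
Lemma projection_small_eq0 (c : R) : c < 1 ->
  (forall xi, l2norm (p xi) <= c * l2norm xi) -> forall xi, p xi = 0.
Proof.
move=> c1 h xi; apply: l2norm0_eq0; have := h (p xi).
rewrite projection_idem => h1; apply/eqP; rewrite eq_le l2norm_ge0 andbT.
have := l2norm_ge0 (p xi); nra.
Qed.

Lemma projection_opnorm1 : p != 0 -> opnorm p = 1.
Proof.
move=> p0; apply/eqP; rewrite eq_le projection_opnorm_le1/= leNgt.
apply: contra p0 => lt1; apply/eqP/BopPeq => xi.
by rewrite (projection_small_eq0 lt1)// => eta; exact: l2norm_Bop_le.
Qed.

(** This links the ghost condition on matrix entries to the norms of the columns [p (delta x)]. *)
Lemma projection_delta_sqr x : normc (entry p x x) = l2norm (p (delta x)) ^+ 2.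
Proof.
by rewrite /entry projection_dot normc_real ger0_norm ?sqr_ge0.
Qed.

End projections.

Lemma projection_neq0_vec (p : Bop R X) : p != 0 -> exists xi, p xi != 0.
Proof.
move=> p0; apply: contrapT => h; move/eqP: p0; apply; apply: BopPeq => xi.
by apply/eqP/negPn/negP => hx; apply: h; exists xi.
Qed.

End operators_basics.

(** * Orthonormal families and projections with finite-dimensional range *)

Section orthonormal_families.
Context {R : realType} {X : choiceType}.
Local Notation H := (ell2 R X).
Implicit Types (xi eta : H) (T : Bop R X) (A B : set X).

Definition orthonormal n (e : 'I_n -> H) : Prop :=
  forall i j, dot (e i) (e j) = (i == j)%:R.

Section family.
Context (n : nat) (e : 'I_n -> H) (oe : orthonormal e).

Lemma orthonormal_norm i : l2norm (e i) = 1.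
Proof.
apply/eqP; rewrite -(@eqrXn2 _ 2)// ?l2norm_ge0//.
by rewrite l2norm_sqrE oe eqxx expr1n.
Qed.

Lemma orthonormal_comb_norm (c : 'I_n -> R[i]) :
  l2norm (\sum_i c i *: e i) ^+ 2 = \sum_i normc (c i) ^+ 2.
Proof.
rewrite pythagoras_sum; last first.
  by move=> i j ij; rewrite dotZl dotZr oe (negbTE ij) !mulr0.
by apply: eq_bigr => i _; rewrite l2normZ orthonormal_norm mulr1.
Qed.

Lemma dot_comb (c : 'I_n -> R[i]) i : dot (\sum_j c j *: e j) (e i) = c i.
Proof.
rewrite dot_suml (bigD1 i)//= big1 ?addr0 => [|j /negbTE ji].
  by rewrite dotZl oe eqxx mulr1.
by rewrite dotZl oe ji mulr0.
Qed.

Lemma dot_proj_diff xi i : dot (xi - \sum_j dot xi (e j) *: e j) (e i) = 0.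
Proof. by rewrite dotBl (dot_comb (fun j => dot xi (e j))) subrr. Qed.

Lemma bessel xi : \sum_i normc (dot xi (e i)) ^+ 2 <= l2norm xi ^+ 2.
Proof.
rewrite -(orthonormal_comb_norm (fun i => dot xi (e i))).
set s := \sum_i _; have -> : l2norm xi = l2norm ((xi - s) + s) by rewrite subrK.
rewrite pythagoras ?lerDr ?sqr_ge0//.
rewrite {2}/s dot_sumr big1// => i _.
by rewrite dotZr dot_proj_diff mulr0.
Qed.

(** The operator with eigenvectors [e i] and eigenvalues [c i] that vanishes on the orthogonal
    complement of the family. *)
Definition diag_op (c : 'I_n -> R[i]) : Bop R X :=
  \sum_i c i *: rank1 (e i) (e i).

Lemma diag_opE c xi : diag_op c xi = \sum_i (c i * dot xi (e i)) *: e i.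
Proof.
rewrite /diag_op Bop_sum; apply: eq_bigr => i _.
by rewrite -scalerA.
Qed.

Lemma diag_op_bound c (M : R) xi : 0 <= M -> (forall i, normc (c i) <= M) ->
  l2norm (diag_op c xi) <= M * l2norm xi.
Proof.
move=> M0 cM; rewrite -ler_sqr ?nnegrE ?mulr_ge0 ?l2norm_ge0//.
rewrite diag_opE (orthonormal_comb_norm (fun i => c i * dot xi (e i))).
rewrite exprMn; apply: le_trans (ler_wpM2l _ (bessel xi)); last exact: sqr_ge0.
rewrite mulr_sumr; apply: ler_sum => i _.
rewrite normcM exprMn ler_wpM2r ?sqr_ge0// ler_sqr ?nnegrE ?normc_ge0//.
Qed.

Lemma diag_op_projection (P : pred 'I_n) :
  projection (diag_op (fun i => (P i)%:R)).
Proof.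
split=> [xi eta|xi].
  rewrite !diag_opE dot_suml dot_sumr; apply: eq_bigr => i _.
  rewrite dotZl dotZr rmorphM/= -dotC conjC_nat; ring.
rewrite !diag_opE; apply: eq_bigr => i _.
rewrite (dot_comb (fun j => (P j)%:R * dot xi (e j))) mulrA.
by case: (P i); rewrite ?mulr1// !mul0r.
Qed.

End family.

Lemma orthonormal_extend n (e : 'I_n -> H) w : orthonormal e ->
  (forall i, dot w (e i) = 0) -> l2norm w = 1 ->
  orthonormal (fun i : 'I_n.+1 => oapp e w (unlift ord_max i)).
Proof.
move=> oe we w1 i j.
have [i'|] := unliftP ord_max i; have [j'|] := unliftP ord_max j => /= -> ->.
- by rewrite oe (inj_eq (@lift_inj _ _)).
- by rewrite dotC we rmorph0 eq_sym (negbTE (neq_lift _ _)).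
- by rewrite we (negbTE (neq_lift _ _)).
- by rewrite dotxx w1 expr1n eqxx.
Qed.

Context (p : Bop R X) (pp : projection p).

(* A bound on the length of linearly independent lists in the range of p,
   witnessed by a coordinate matrix that detects linear relations. *)
Definition range_dim_le (N : nat) : Prop :=
  forall n (e : 'I_n -> H), (forall i, p (e i) = e i) ->
  exists M : 'M[R[i]]_(n, N), forall c : 'rV[R[i]]_n,
    c *m M = 0 -> \sum_i c 0 i *: e i = 0.

(** A row vector killed by [M] gives a vanishing combination of the [e i], whose coefficients are
    zero by orthonormality. Hence [M] has full row rank. *)
Lemma orthonormal_size_le N n (e : 'I_n -> H) : range_dim_le N ->
  orthonormal e -> (forall i, p (e i) = e i) -> (n <= N)%N.
Proof.
move=> dN oe pe; have [M MP] := dN _ _ pe.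
suff /eqP <- : row_free M by exact: rank_leq_col.
rewrite -kermx_eq0; apply/eqP/row_matrixP => i; rewrite row0.
have := MP (row i (kermx M)); rewrite -row_mul mulmx_ker row0 => /(_ erefl) h.
apply/rowP => j; rewrite [RHS]mxE -(dot_comb oe (fun j => row i (kermx M) 0 j)).
by rewrite h dot0l.
Qed.

(** Take an orthonormal family in the range of maximal size. If some [p xi] differed from its
    expansion, the normalised remainder would extend the family. *)
Lemma finite_range_basis N : range_dim_le N ->
  exists n (e : 'I_n -> H), [/\ orthonormal e, forall i, p (e i) = e i &
    forall xi, p xi = \sum_i dot xi (e i) *: e i].
Proof.
move=> dN.
pose Q n := `[< exists e : 'I_n -> H, orthonormal e /\ forall i, p (e i) = e i >].
have Q0 : exists n, Q n.
  by exists 0%N; apply/asboolP; exists (fun=> 0); split; case.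
have Qb n : Q n -> (n <= N)%N.
  by move=> /asboolP[e [oe pe]]; exact: orthonormal_size_le pe.
case: (ex_maxnP Q0 Qb) => n /asboolP[e [oe pe]] nmax.
exists n, e; split => // xi.
have pxe i : dot (p xi) (e i) = dot xi (e i) by rewrite projection_self// pe.
set s := \sum_i _.
apply/eqP; rewrite -subr_eq0; apply/negPn/negP => d0.
have [r r0 r1] := unit_normalize d0.
suff : (n.+1 <= n)%N by rewrite ltnn.
apply: nmax; apply/asboolP.
exists (fun i => oapp e (r%:C *: (p xi - s)) (unlift ord_max i)); split.
  apply: orthonormal_extend => // i.
  rewrite dotZl (_ : s = \sum_j dot (p xi) (e j) *: e j) ?dot_proj_diff ?mulr0//.
  by apply: eq_bigr => j _; rewrite pxe.
move=> i; case: unliftP => [j _ //=|_] /=.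
rewrite linearZ linearB/= projection_idem//; congr (_ *: (_ - _)).
by rewrite /s linear_sum/=; apply: eq_bigr => j _; rewrite linearZ/= pe.
Qed.

End orthonormal_families.

(** * Compact projections *)

Section compactness.
Context {R : realType} {X : choiceType}.
Local Notation H := (ell2 R X).
Implicit Types (xi eta : H) (p T : Bop R X) (A B F : set X).

Lemma finite_set_enum F : finite_set F -> exists m (x : 'I_m -> X),
  [/\ injective x, F = range x &
    forall xi, chi F xi = \sum_i xi (x i) *: delta (x i)].
Proof.
move=> /finite_set_uniq_seq[s us ->].
exists (size s), (tnth (in_tuple s)); split.
- exact/tuple_uniqP.
- apply/seteqP; split => [x /= xs|_ [i _ <-]]; last exact: mem_tnth.
  by have /tnthP[i ->] : x \in in_tuple s by []; exists i.
- by move=> xi; rewrite chi_finE// big_tnth.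
Qed.

Lemma line_continuous (w : H) : continuous (fun t : R => t%:C *: w).
Proof.
move=> t; apply/cvgrPdist_le => _ /posC[e e0 ->].
have w1 : 0 < l2norm w + 1 by rewrite ltr_wpDl// l2norm_ge0.
have d0 : 0 < e / (l2norm w + 1) by exact: divr_gt0.
exists (e / (l2norm w + 1)) => // u /= /ltW.
rewrite ell2_normE lecR -scalerBl -realCB l2normZ normc_real.
rewrite ler_pdivlMr// => h; apply: le_trans h.
by rewrite ler_wpM2l// lerDl.
Qed.

(** By induction, the combinations with real coefficients in [-1, 1] form the image of a product of
    segments under addition. Complex coefficients are reached later by adjoining the vectors
    multiplied by ['i]. *)
Lemma compact_span n (w : 'I_n -> H) : exists2 K : set H, compact K &
  forall t : 'I_n -> R, (forall i, `|t i| <= 1) -> K (\sum_i (t i)%:C *: w i).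
Proof.
elim: n w => [|n IH] w.
  exists [set 0]; first exact: compact_set1.
  by move=> t _; rewrite big_ord0.
have [K cK KP] := IH (fun i => w (widen_ord (leqnSn n) i)).
pose L := [set (t : R)%:C *: w ord_max | t in `[(-1 : R), 1]%classic].
have cL : compact L.
  apply: continuous_compact; last exact: segment_compact.
  by apply: continuous_subspaceT; exact: line_continuous.
exists [set z.1 + z.2 | z in K `*` L].
  apply: continuous_compact; last exact: compact_setX.
  by apply: continuous_subspaceT; exact: add_continuous.
move=> t t1; rewrite big_ord_recr/=.
exists (\sum_(i < n) (t (widen_ord (leqnSn n) i))%:C *: w (widen_ord (leqnSn n) i),
        (t ord_max)%:C *: w ord_max) => //=.
split; first by apply: (KP (fun i => t (widen_ord (leqnSn n) i))).
by exists (t ord_max) => //=; rewrite in_itv/= -ler_norml.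
Qed.

Lemma scale_ReIm (z : R[i]) (v : H) :
  (complex.Re z)%:C *: v + (complex.Im z)%:C *: ('i%C *: v) = z *: v.
Proof. by rewrite scalerA -scalerDl [_ * 'i%C]mulrC -complexE. Qed.

(** In an orthonormal basis of the range, the image of the unit ball has coefficients whose real and
    imaginary parts are bounded by 1, so it lies in a sum of two compact sets. *)
Lemma finite_range_compact p N : projection p -> range_dim_le p N -> compact_op p.
Proof.
move=> pp /(finite_range_basis pp)[n [e [oe _ pE]]].
have [K cK KP] := compact_span e.
have [L cL LP] := compact_span (fun i => 'i%C *: e i).
pose KL := [set z.1 + z.2 | z in K `*` L].
have cKL : compact KL.
  apply: continuous_compact; last exact: compact_setX.
  by apply: continuous_subspaceT; exact: add_continuous.
apply: (@precompact_subset _ _ KL); last first.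
  by apply: compact_precompact => //; exact: norm_hausdorff.
move=> _ [xi /= xi1 <-].
have c1 i : normc (dot xi (e i)) <= 1.
  apply: le_trans (normc_dot_le _ _) _.
  by rewrite (orthonormal_norm oe) mulr1.
exists (\sum_i (complex.Re (dot xi (e i)))%:C *: e i,
        \sum_i (complex.Im (dot xi (e i)))%:C *: ('i%C *: e i)).
  split.
    by apply: (KP (fun i => complex.Re (dot xi (e i)))) => i;
      apply: le_trans (Re_abs_le_normc _) _.
  by apply: (LP (fun i => complex.Im (dot xi (e i)))) => i;
    apply: le_trans (Im_abs_le_normc _) _.
rewrite pE; under [RHS]eq_bigr => i _ do rewrite -scale_ReIm.
by rewrite big_split.
Qed.

Lemma finite_rank_range_dim p : finite_rank p -> exists N, range_dim_le p N.
Proof.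
move=> [N [v vP]]; exists N => n e pe.
have [c cP] := choice vP.
exists (\matrix_(i, j) c (e i) j) => l l0.
under eq_bigr => i _ do rewrite -(pe i) cP scaler_sumr.
rewrite exchange_big/= big1// => j _.
under eq_bigr => i _ do rewrite scalerA.
rewrite -scaler_suml (_ : \sum_i _ = 0) ?scale0r//.
have /rowP/(_ j) := l0; rewrite !mxE; apply: etrans.
by apply: eq_bigr => i _; rewrite mxE.
Qed.

(** The matrix records coordinates on [F]. A vector [v] of the range that vanishes on [F] satisfies
    [l2norm v <= d * l2norm v], hence is zero. *)
Lemma localised_range_dim p F (d : R) : d < 1 -> finite_set F ->
  (forall xi, l2norm (p xi - chi F (p xi)) <= d * l2norm xi) ->
  exists N, range_dim_le p N.
Proof.
move=> d1 /finite_set_enum[N [x [_ FE chiFE]]] pF; exists N => n e pe.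
exists (\matrix_(i, j) e i (x j)) => l l0.
set v := \sum_i _; have pv : p v = v.
  by rewrite linear_sum/=; apply: eq_bigr => i _; rewrite linearZ/= pe.
apply: l2norm0_eq0; have := pF v; rewrite pv chiFE big1 => [|j _].
  by rewrite subr0; have := l2norm_ge0 v => ? ?; apply/eqP;
    rewrite eq_le l2norm_ge0 andbT; nra.
rewrite (_ : v (x j) = 0) ?scale0r// /v ell2_sum.
have /rowP/(_ j) := l0; rewrite !mxE; apply: etrans.
by apply: eq_bigr => i _; rewrite mxE.
Qed.

Lemma localised_compact p F (d : R) : projection p -> d < 1 -> finite_set F ->
  (forall xi, l2norm (p xi - chi F (p xi)) <= d * l2norm xi) -> compact_op p.
Proof.
move=> pp d1 fF /(localised_range_dim d1 fF)[N].
exact: finite_range_compact.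
Qed.

(** Only finitely many basis vectors of the range need their tails cut off, which makes the estimate
    uniform in [xi]. *)
Lemma finite_rank_tail p (e : R) : 0 < e -> projection p -> finite_rank p ->
  exists F, finite_set F /\ forall B, F `<=` B ->
    forall xi, l2norm (p xi - chi B (p xi)) <= e * l2norm xi.
Proof.
move=> e0 pp /finite_rank_range_dim[N /(finite_range_basis pp)[n [v [ov _ pE]]]].
have n0 : 0 < (n.+1%:R : R) by rewrite ltr0n.
have [F FP] := choice (fun i => tail_small (v i) (divr_gt0 e0 n0)).
exists (\bigcup_(i in [set: 'I_n]) F i); split.
  by apply: bigcup_finite; [exact: finite_finset|move=> i _; case: (FP i)].
move=> B FB xi; rewrite chi_complB pE linear_sum.
apply: le_trans (ler_l2norm_sum _ _ _) _.
apply: (@le_trans _ _ (\sum_(i < n) l2norm xi * (e / n.+1%:R))).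
  apply: ler_sum => i _; rewrite linearZ l2normZ.
  apply: ler_pM; [exact: normc_ge0|exact: l2norm_ge0| |].
    by apply: le_trans (normc_dot_le _ _) _; rewrite (orthonormal_norm ov) mulr1.
  by case: (FP i) => _; apply => x Fx; apply: FB; exists i.
rewrite sumr_const card_ord -mulrnAr mulrC ler_wpM2r ?l2norm_ge0//.
rewrite -[_ *+ n]mulr_natr -mulrA ler_piMr ?(ltW e0)//.
by rewrite mulrC ler_pdivrMr// mul1r ler_nat.
Qed.

(** The vectors [u n] lie in the image of the unit ball. A cluster point would have two of them
    within distance less than 1/2, contradicting their separation. *)
Lemma not_compact p (u : nat -> H) : (forall n, l2norm (u n) <= 1) ->
  (forall n, p (u n) = u n) ->
  (forall n m, (n < m)%N -> 1 <= l2norm (u n - u m)) -> ~ compact_op p.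
Proof.
move=> u1 pu ud [K Kp [cK _]].
have [|z [_ zc]] := cK (u @ \oo).
  exists 0%N => // n _ /=; apply: Kp; exists (u n) => //=; exact: u1.
have Bz : nbhs z (ball z ((1 / 2 : R)%:C : R[i])).
  by apply: nbhsx_ballx; rewrite ltcR divr_gt0.
have get N : exists2 n, (N <= n)%N & l2norm (z - u n) < 1 / 2.
  have [|_ [[n /= Nn <-]]] := zc [set u n | n in [set n | (N <= n)%N]] _ _ Bz.
    by exists N => // n /= Nn; exists n.
  by rewrite ball_ell2; exists n.
have [n _ zn] := get 0%N; have [m nm zm] := get n.+1.
have := ud _ _ nm; apply/negP; rewrite -ltNge.
apply: le_lt_trans (ler_l2dist z _ _) _; rewrite l2normBC.
by apply: lt_le_trans (ltrD zn zm) _; rewrite -mulrDl divff.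
Qed.

Lemma supported_finite_rank p F : finite_set F ->
  (forall xi, chi F (p xi) = p xi) -> finite_rank p.
Proof.
move=> /finite_set_enum[m [x [_ _ chiE']]] pF.
exists m, (fun i => delta (x i)) => xi; exists (fun i => p xi (x i)).
by rewrite -chiE' pF.
Qed.

End compactness.

(** * Rounding almost projections *)

Section spectral_rounding.
Context {R : realType} {X : choiceType}.
Local Notation H := (ell2 R X).
Implicit Types (xi eta : H) (p T : Bop R X) (A B F : set X).

(** The spectral theorem for the Hermitian matrix of [T] on the span of the [delta x] with [x] in
    [F], carried back to the Hilbert space. *)
Lemma selfadjoint_diagonalisable T F : finite_set F ->
  (forall xi eta, dot (T xi) eta = dot xi (T eta)) ->
  (forall xi, chi F (T xi) = T xi) ->
  exists m (e : 'I_m -> H) (d : 'I_m -> R[i]),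
    [/\ orthonormal e, forall i, chi F (e i) = e i,
        forall i, T (e i) = d i *: e i &
        forall xi, chi F xi = \sum_i dot xi (e i) *: e i].
Proof.
move=> /(@finite_set_enum R)[m [x [xI FE chiE']]] Ts TF.
pose A : 'M[R[i]]_m := \matrix_(i, j) T (delta (x j)) (x i).
have AA : (A ^t* )%sesqui = A.
  apply/matrixP => i j; rewrite !mxE -!dot_delta.
  by rewrite Ts [RHS]dotC.
have An : A \is normalmx by apply/normalmxP; rewrite AA.
pose U := spectralmx A; pose d := spectral_diag A.
have Uu : U \is unitarymx by exact: spectral_unitarymx.
have AE : A = (U ^t* )%sesqui *m diag_mx d *m U.
  by have /orthomx_spectralP := An; rewrite -/U -/d invmx_unitary.
have UU : U *m (U ^t* )%sesqui = 1%:M by exact/unitarymxP.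
have UU' : (U ^t* )%sesqui *m U = 1%:M by exact: mulmx1C.
have AU : A *m (U ^t* )%sesqui = (U ^t* )%sesqui *m diag_mx d.
  by rewrite AE -!mulmxA UU mulmx1.
(* The eigenvectors are the columns of the adjoint of [U]; [AU] is the eigenvalue equation.
   Orthonormality will come from [UU], completeness on [F] from [UU']. *)
pose e k : H := \sum_i Num.conj (U k i) *: delta (x i).
have ex k i : e k (x i) = Num.conj (U k i).
  rewrite ell2_sum (bigD1 i)// big1 => [|j ji].
    by rewrite [LHS]addr0 ell2Z deltaE eqxx mulr1.
  by rewrite ell2Z deltaE (inj_eq xI) eq_sym (negbTE (ji : j != i)) mulr0.
have Fx i : F (x i) by rewrite FE; exists i.
have eF k : chi F (e k) = e k.
  rewrite linear_sum; apply: eq_bigr => i _.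
  by rewrite linearZ; congr (_ *: _); rewrite [LHS]chi_delta mem_set.
have de xi k : dot xi (e k) = \sum_i xi (x i) * U k i.
  rewrite dot_sumr; apply: eq_bigr => i _.
  by rewrite dotZr conjCK dot_delta mulrC.
exists m, e, (fun k => d 0 k); split => //.
- move=> k l; rewrite de.
  have /matrixP/(_ l k) := UU; rewrite !mxE [k == l]eq_sym => <-.
  by apply: eq_bigr => i _; rewrite ex !mxE mulrC.
- move=> k; apply: ell2P_eq => y.
  have [|Fy] := pselect (F y); last first.
    by rewrite ell2Z -(TF (e k)) -(eF k) !chi_out// mulr0.
  rewrite FE => -[i _ <-].
  rewrite ell2Z ex linear_sum ell2_sum.
  have /matrixP/(_ i k) := AU; rewrite [RHS]mxE (bigD1 k)//= big1 => [|j jk].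
    rewrite !mxE eqxx mulr1n addr0 mulrC => <-.
    by apply: eq_bigr => j _; rewrite linearZ ell2Z !mxE mulrC.
  by rewrite !mxE (negbTE jk) mulr0n mulr0.
- move=> xi; rewrite chiE'; apply/esym.
  under eq_bigr => k _ do rewrite de scaler_suml.
  under eq_bigr => k _ do under eq_bigr => i _ do rewrite scaler_sumr.
  (* The coefficient of [delta (x i)] is a sum over [j] of [xi (x j)] times an entry of the product
     in [UU'], so only [j = i] survives. *)
  rewrite exchange_big/=; apply: eq_bigr => i _.
  rewrite exchange_big/= (bigD1 i)//= [X in _ + X]big1 ?addr0 => [|j ji].
    under eq_bigr => k _ do rewrite scalerA -mulrA.
    rewrite -scaler_suml -mulr_sumr.
    have /matrixP/(_ i i) := UU'; rewrite !mxE eqxx => E.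
    rewrite (_ : \sum_k _ = 1) ?mulr1// -[RHS]E.
    by apply: eq_bigr => k _; rewrite !mxE mulrC.
  under eq_bigr => k _ do rewrite scalerA -mulrA.
  rewrite -scaler_suml -mulr_sumr.
  have /matrixP/(_ j i) := UU'; rewrite !mxE (negbTE ji) => E.
  rewrite (_ : \sum_k _ = 0) ?mulr0 ?scale0r// -[RHS]E.
  by apply: eq_bigr => k _; rewrite !mxE mulrC.
Qed.

(* The spectrum of [T] lies within [2 d] of [{0, 1}]: round it. *)
Lemma almost_projection T F (d : R) : finite_set F -> 0 <= d ->
  (forall xi eta, dot (T xi) eta = dot xi (T eta)) ->
  (forall xi, chi F (T xi) = T xi) -> (forall xi, T (chi F xi) = T xi) ->
  (forall xi, l2norm (T (T xi) - T xi) <= d * l2norm xi) ->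
  exists q, [/\ projection q, forall xi, chi F (q xi) = q xi,
    forall xi, q (chi F xi) = q xi &
    forall xi, l2norm (q xi - T xi) <= 2 * d * l2norm xi].
Proof.
move=> fF d0 Ts TF FT TT.
have [m [e [l [oe eF Te chiFE]]]] := selfadjoint_diagonalisable fF Ts TF.
(* Either modulus of [l i] or of [l i - 1] is at least 1/2, while their product is at most [d].
   Rounding at 1/2 therefore moves each eigenvalue by at most [2 * d]. *)
pose P i := 1 / 2 < normc (l i).
have lP i : normc ((P i)%:R - l i) <= 2 * d.
  have := TT (e i); rewrite Te BopvZ Te scalerA.
  rewrite -scalerBl l2normZ (orthonormal_norm oe) !mulr1.
  have -> : l i * l i - l i = l i * (l i - 1) by rewrite mulrBr mulr1.
  rewrite normcM /P.
  have h1 := normc_ge0 (l i); have h2 := normc_ge0 (l i - 1).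
  have h3 : 1 <= normc (l i) + normc (l i - 1).
    have := ler_normcD (l i) (- (l i - 1)).
    by rewrite opprB addrC subrK normc1 -opprB normcN.
  case: ltP => hl hd.
    by rewrite mulr1n -opprB normcN; nra.
  by rewrite mulr0n sub0r normcN; nra.
have TE xi : T xi = \sum_i (l i * dot xi (e i)) *: e i.
  rewrite -FT chiFE linear_sum; apply: eq_bigr => i _.
  by rewrite linearZ/= Te scalerA mulrC.
have eFd xi i : dot (chi F xi) (e i) = dot xi (e i) by rewrite chi_self eF.
exists (diag_op e (fun i => (P i)%:R)); split.
- exact: diag_op_projection.
- move=> xi; rewrite diag_opE linear_sum; apply: eq_bigr => i _.
  by rewrite linearZ; congr (_ *: _); exact: eF.
- by move=> xi; rewrite !diag_opE; apply: eq_bigr => i _; rewrite eFd.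
- move=> xi; rewrite (_ : _ - _ = diag_op e (fun i => (P i)%:R - l i) xi).
    by apply: diag_op_bound => //; rewrite mulr_ge0.
  rewrite !diag_opE TE -sumrB; apply: eq_bigr => i _.
  by rewrite -scalerBl -mulrBl.
Qed.

End spectral_rounding.

(** * Direct sums along disjoint finite blocks *)

Lemma finite_set_real_ub (eT : choiceType) (A : set eT) (R : realType) (f : eT -> R) :
  finite_set A -> exists2 M : R, 0 < M & forall x, A x -> f x <= M.
Proof.
move=> /finite_seqP[s ->]; elim: s => [|a s [M M0 MP]]; first by exists 1.
exists (Num.max M (f a)); first by rewrite lt_max M0.
move=> x /=; rewrite inE => /orP[/eqP ->|/MP h]; first by rewrite le_max lexx orbT.
by rewrite le_max h.
Qed.

Lemma finite_set_nat_ub (eT : choiceType) (A : set eT) (f : eT -> nat) :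
  finite_set A -> exists N, forall x, A x -> (f x < N)%N.
Proof.
move=> /finite_seqP[s ->]; elim: s => [|a s [M MP]]; first by exists 0%N.
exists (maxn M (f a).+1).
move=> x /=; rewrite inE => /orP[/eqP ->|/MP h]; first by rewrite leq_max ltnSn orbT.
by rewrite leq_max h.
Qed.

(** Inductive choice of objects, each compatible with the finite union of the sets chosen before it.
    It produces disjoint blocks in one direction of the proof and distant blocks in another. *)
Lemma greedy_sequence (T Z : Type) (F : Z -> set T) (P : nat -> set T -> Z -> Prop) :
  (forall k B, finite_set B -> exists2 z, finite_set (F z) & P k B z) ->
  exists z : nat -> Z, forall k, finite_set (F (z k)) /\
    P k (\bigcup_(j in `I_k) F (z j)) (z k).
Proof.
move=> step; have [z0 _ _] := step 0%N set0 (finite_set0 T).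
have [g gP] : exists g : nat * set T -> Z, forall u, finite_set u.2 ->
    finite_set (F (g u)) /\ P u.1 u.2 (g u).
  suff /choice[g gP] : forall u : nat * set T, exists z, finite_set u.2 ->
      finite_set (F z) /\ P u.1 u.2 z by exists g.
  (* [z0] is a dummy value for infinite [B], which makes the choice function total; the recursion
     below only meets finite sets. *)
  move=> [k B]; have [fB|nB] := pselect (finite_set B); last by exists z0.
  by have [z zF zP] := step k B fB; exists z.
pose fix B k := if k is k'.+1 then B k' `|` F (g (k', B k')) else set0.
have fB k : finite_set (B k).
  elim: k => [|k IH] /=; first exact: finite_set0.
  by rewrite finite_setU; split => //; case: (gP (k, B k) IH).
have BE k : B k = \bigcup_(j in `I_k) F (g (j, B j)).
  elim: k => [|k IH] /=; first by rewrite II0 bigcup_set0.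
  by rewrite IIS bigcup_setU bigcup_set1 -IH.
exists (fun k => g (k, B k)) => k.
by rewrite -BE; exact: (gP (k, B k) (fB k)).
Qed.

Section direct_sums.
Context {R : realType} {X : choiceType}.
Local Notation H := (ell2 R X).
Implicit Types (xi eta : H) (A B : set X).

Context (F : nat -> set X) (tF : trivIset [set: nat] F).

Local Notation G K := (\bigcup_(n in `I_K) F n).
Local Notation U := (\bigcup_n F n).

Lemma block_index_uniq n m x : F n x -> F m x -> n = m.
Proof. by move=> Fn Fm; apply: tF => //; exists x. Qed.

Lemma chi_partial K xi : chi (G K) xi = \sum_(n < K) chi (F n) xi.
Proof.
apply: ell2P_eq => x; rewrite ell2_sum.
have [[n nK Fn]|nG] := pselect (G K x).
  rewrite chi_in; last by exists n.
  rewrite (bigD1 (Ordinal nK))// big1 => [|m mn].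
    by rewrite [RHS]addr0 (@chi_in _ _ (F n)).
  rewrite chi_out// => Fm; have /eqP := mn; apply; apply: val_inj.
  exact: block_index_uniq Fm Fn.
rewrite chi_out// big1// => n _; rewrite chi_out// => Fn.
by apply: nG; exists n => /=.
Qed.

Lemma dot_blocks n m xi eta : n != m -> dot (chi (F n) xi) (chi (F m) eta) = 0.
Proof.
move=> nm; apply: dot_disjoint => x.
have [Fn|nFn] := pselect (F n x); [right|by left; apply: chi_out].
apply: chi_out => Fm; move/eqP: nm; apply; exact: block_index_uniq Fn Fm.
Qed.

Lemma block_sum_norm K (v : nat -> H) : (forall n, chi (F n) (v n) = v n) ->
  l2norm (\sum_(n < K) v n) ^+ 2 = \sum_(n < K) l2norm (v n) ^+ 2.
Proof.
move=> vF; rewrite (pythagoras_sum (F := fun n : 'I_K => v n))// => n m nm.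
by rewrite -(vF n) -(vF m) dot_blocks.
Qed.

Lemma block_sum_le K (v : nat -> H) (M : R) xi : 0 <= M ->
  (forall n, chi (F n) (v n) = v n) ->
  (forall n, l2norm (v n) <= M * l2norm (chi (F n) xi)) ->
  l2norm (\sum_(n < K) v n) <= M * l2norm xi.
Proof.
move=> M0 vF vM; rewrite -ler_sqr ?nnegrE ?mulr_ge0 ?l2norm_ge0//.
rewrite block_sum_norm//.
apply: (@le_trans _ _ (M ^+ 2 * l2norm (chi (G K) xi) ^+ 2)); last first.
  by rewrite exprMn ler_wpM2l ?sqr_ge0// ler_sqr ?nnegrE ?l2norm_ge0// chi_le.
rewrite chi_partial (@block_sum_norm _ (fun n => chi (F n) xi)); last first.
  by move=> n; exact: chi_idem.
rewrite mulr_sumr; apply: ler_sum => n _.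
by rewrite -exprMn ler_sqr ?nnegrE ?mulr_ge0 ?l2norm_ge0.
Qed.

Lemma finite_in_partial A : finite_set A ->
  exists K, forall x, A x -> U x -> G K x.
Proof.
(* [xget] returns the index of the block containing [x], and 0 for points in no block. *)
move=> fA; have [K KP] := finite_set_nat_ub (fun x => xget 0%N [set n | F n x]) fA.
exists K => x Ax [n _ Fn]; exists (xget 0%N [set n | F n x]); first exact: KP.
exact: (@xgetPex _ 0%N [set n | F n x] (ex_intro _ n Fn)).
Qed.

Lemma block_tail xi (e : R) : (forall x, ~ U x -> xi x = 0) -> 0 < e ->
  exists K, forall K', (K <= K')%N -> l2norm (xi - chi (G K') xi) <= e.
Proof.
move=> xU e0; have [A [fA AP]] := tail_small xi e0.
have [K KP] := finite_in_partial fA; exists K => K' KK'.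
have := AP (A `|` G K') (@subsetUl _ _ _); apply: le_trans.
rewrite chi_complB; apply: l2norm_le_abs => x.
have [Gx|nGx] := pselect (G K' x).
  by rewrite chi_out ?normc0 ?normc_ge0//; apply.
rewrite chi_in//; have [Ux|nUx] := pselect (U x); last by rewrite xU ?normc0 ?normc_ge0.
rewrite chi_in// => -[Ax|//]; apply: nGx.
have [n nK Fn] := KP _ Ax Ux.
by exists n => //=; exact: leq_trans KK'.
Qed.

(** The operator is defined coordinatewise: on [F n] it has the values of [T n], elsewhere 0. Every
    finite partial sum of squares is dominated by a finite block sum, and orthogonality of the
    blocks bounds these uniformly. *)
Lemma direct_sum (T : nat -> Bop R X) (M : R) : 0 <= M ->
  (forall n xi, chi (F n) (T n xi) = T n xi) ->
  (forall n xi, T n (chi (F n) xi) = T n xi) ->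
  (forall n xi, l2norm (T n xi) <= M * l2norm xi) ->
  exists q : Bop R X, [/\ forall n x xi, F n x -> q xi x = T n xi x,
    forall x xi, ~ U x -> q xi x = 0 &
    forall xi, l2norm (q xi) <= M * l2norm xi].
Proof.
move=> M0 FT TF TM.
pose idx x := xget 0%N [set n | F n x].
have idxP n x : F n x -> idx x = n.
  move=> Fn; apply: (block_index_uniq _ Fn).
  exact: (@xgetPex _ 0%N [set n | F n x] (ex_intro _ n Fn)).
pose f xi x : R[i] := if x \in U then T (idx x) xi x else 0.
have fin n x xi : F n x -> f xi x = T n xi x.
  by move=> Fn; rewrite /f mem_set; [rewrite (idxP _ _ Fn)|exists n].
have fout x xi : ~ U x -> f xi x = 0.
  by move=> Ux; rewrite /f memNset.
have fsum xi : (sqsum (f xi) <= ((M * l2norm xi) ^+ 2)%:E)%E.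
  apply: ge_ereal_sup => _ [A [fA _] <-].
  have [K KP] := finite_in_partial fA.
  pose v := \sum_(n < K) T n xi.
  have vM : l2norm v <= M * l2norm xi.
    apply: (@block_sum_le K (fun n => T n xi)) => // n.
    by rewrite -{1}(TF n xi).
  apply: (@le_trans _ _ (l2norm v ^+ 2)%:E); last first.
    by rewrite lee_fin ler_sqr ?nnegrE ?mulr_ge0 ?l2norm_ge0.
  rewrite l2norm_sqr; apply: esum_ge; exists A => //.
  apply: lee_fsum => // x Ax; rewrite lee_fin ler_sqr ?nnegrE ?normc_ge0//.
  have [Ux|nUx] := pselect (U x); last by rewrite fout// normc0 normc_ge0.
  have [n nK Fn] := KP _ Ax Ux.
  rewrite (fin n)// /v ell2_sum (bigD1 (Ordinal nK))// big1 => [|m mn].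
    by rewrite [X in normc X <= _]/= [X in _ <= normc X]addr0.
  rewrite -FT chi_out// => Fm; have /eqP := mn; apply; apply: val_inj.
  exact: block_index_uniq Fm Fn.
have fl2 xi : f xi \in sqsummable.
  by rewrite inE/=; apply: le_lt_trans (fsum xi) _; rewrite ltry.
pose g xi : H := Ell2 (fl2 xi).
have gM xi : l2norm (g xi) <= M * l2norm xi.
  rewrite -ler_sqr ?nnegrE ?mulr_ge0 ?l2norm_ge0// -lee_fin l2norm_sqr.
  exact: fsum.
have gb : g \in bounded_op.
  apply: mkBop_subproof; last by exists M.
  move=> c xi eta; apply: ell2P_eq => x.
  rewrite ell2D ell2Z -![g _ x]/(f _ x) /f; case: ifP => _.
    by rewrite linearP.
  by rewrite mulr0 addr0.
by exists (MkBop gb).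
Qed.

(** * Properties inherited by a direct sum from its blocks *)

Section direct_sum_theory.
Context (T : nat -> Bop R X) (q : Bop R X).
Context (FT : forall n xi, chi (F n) (T n xi) = T n xi).
Context (TF : forall n xi, T n (chi (F n) xi) = T n xi).
Context (qin : forall n x xi, F n x -> q xi x = T n xi x).
Context (qout : forall x xi, ~ U x -> q xi x = 0).

Lemma direct_sum_chil n xi : chi (F n) (q xi) = T n xi.
Proof.
rewrite -FT; apply: ell2P_eq => x.
have [Fx|nFx] := pselect (F n x); last by rewrite !chi_out.
by rewrite !chi_in// (qin _ Fx).
Qed.

Lemma direct_sum_chir n xi : q (chi (F n) xi) = T n xi.
Proof.
apply: ell2P_eq => x.
have [[m _ Fx]|nUx] := pselect (U x); last first.
  rewrite qout// -FT chi_out// => Fx; apply: nUx; by exists n.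
rewrite (qin _ Fx) -TF; have [nm|nm] := eqVneq n m.
  by rewrite nm chi_idem TF.
rewrite (_ : chi (F m) _ = 0).
  rewrite linear0 -FT chi_out// => Fn; move/eqP: nm; apply.
  exact: block_index_uniq Fn Fx.
apply: ell2P_eq => y; rewrite chiI chi_out// => -[Fm Fn].
by move/eqP: nm; apply; exact: block_index_uniq Fn Fm.
Qed.

Lemma direct_sum_partial K xi : chi (G K) (q xi) = \sum_(n < K) T n xi.
Proof. by rewrite chi_partial; apply: eq_bigr => n _; exact: direct_sum_chil. Qed.

Lemma direct_sum_projection : (forall n, projection (T n)) -> projection q.
Proof.
move=> Tp; split; last first.
  move=> xi; apply: ell2P_eq => x.
  have [[n _ Fx]|nUx] := pselect (U x); last by rewrite !qout.
  rewrite !(qin _ Fx) -TF direct_sum_chil.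
  by rewrite (projection_idem (Tp n)).
move=> xi eta; apply/eqP; rewrite -subr_eq0; apply/eqP/eq0_normc.
apply/eqP; rewrite eq_le normc_ge0 andbT; apply/ler_addgt0Pr => e e0.
have qU zeta x : ~ U x -> q zeta x = 0 by exact: qout.
(* Idempotence was checked coordinatewise; self-adjointness holds exactly for finite block sums and
   passes to the limit. The summand 1 keeps [c] positive. *)
pose c := l2norm xi + l2norm eta + 1.
have c0 : 0 < c by rewrite ltr_wpDl// addr_ge0// l2norm_ge0.
have [K1 K1P] := block_tail (qU xi) (divr_gt0 e0 c0).
have [K2 K2P] := block_tail (qU eta) (divr_gt0 e0 c0).
pose K := maxn K1 K2.
have {}K1P := K1P K (leq_maxl _ _); have {}K2P := K2P K (leq_maxr _ _).
have E : dot (chi (G K) (q xi)) eta = dot xi (chi (G K) (q eta)).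
  rewrite !direct_sum_partial dot_suml dot_sumr; apply: eq_bigr => n _.
  exact: projection_self.
have -> : dot (q xi) eta - dot xi (q eta) =
    dot (q xi - chi (G K) (q xi)) eta - dot xi (q eta - chi (G K) (q eta)).
  by rewrite dotBl dotBr E opprB addrA subrK.
rewrite add0r; apply: le_trans (ler_normcD _ _) _; rewrite normcN.
have h1 := normc_dot_le (q xi - chi (G K) (q xi)) eta.
have h2 := normc_dot_le xi (q eta - chi (G K) (q eta)).
apply: le_trans (lerD h1 h2) _.
have x0 := l2norm_ge0 xi; have y0 := l2norm_ge0 eta.
apply: (@le_trans _ _ (e / c * l2norm eta + l2norm xi * (e / c))).
  by rewrite lerD// ?ler_wpM2r ?ler_wpM2l.
rewrite [l2norm xi * _]mulrC -mulrDr mulrAC ler_pdivrMr// ler_wpM2l ?(ltW e0)//.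
by rewrite /c addrC ler_wpDr.
Qed.

Lemma direct_sum_series xi :
  series (fun n => chi (F n) (q (chi (F n) xi))) @ \oo --> q xi.
Proof.
apply/cvg_l2P => e e0; have [K KP] := block_tail (fun x => @qout x xi) e0.
exists K => K' /KP; rewrite direct_sum_partial seriesEord.
apply: le_trans; rewrite le_eqVlt; apply/orP; left; apply/eqP.
congr (l2norm (_ - _)); apply: eq_bigr => n _.
by rewrite direct_sum_chir FT.
Qed.

End direct_sum_theory.

End direct_sums.

(** * Propagation *)

Section metric_lemmas.
Context {R : realType} {X : metricType R}.
Local Notation H := (ell2 R X).
Implicit Types (xi eta : H) (A B F : set X) (b p q : Bop R X) (s : R).

Lemma propP b s : (prop b <= s%:E)%E <->
  forall x y, b (delta x) y != 0 -> mdist x y <= s.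
Proof.
split=> [h x y bxy|h].
  rewrite -lee_fin; apply: le_trans h; apply: ereal_sup_ubound.
  by exists (x, y) => //=; rewrite dot_delta.
apply: ge_ereal_sup => _ [[x y] /= xy <-]; rewrite lee_fin; apply: h.
by rewrite dot_delta in xy.
Qed.

Lemma diamP A s : (diam A <= s%:E)%E <->
  forall x y, A x -> A y -> mdist x y <= s.
Proof.
split=> [h x y Ax Ay|h].
  rewrite -lee_fin; apply: le_trans h; apply: ereal_sup_ubound.
  by exists (x, y).
by apply: ge_ereal_sup => _ [[x y] /= [Ax Ay] <-]; rewrite lee_fin; apply: h.
Qed.

Lemma set_dist_ge A B s : (forall x y, A x -> B y -> s <= mdist x y) ->
  (s%:E <= set_dist A B)%E.
Proof.
move=> h; apply: le_ereal_inf_tmp => _ [[x y] /= [Ax By] <-].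
by rewrite lee_fin; exact: h.
Qed.

Lemma lt_set_dist A B s : (s%:E < set_dist A B)%E ->
  forall x y, A x -> B y -> s < mdist x y.
Proof.
move=> h x y Ax By; rewrite -lte_fin; apply: lt_le_trans h _.
by apply: ereal_inf_lbound; exists (x, y).
Qed.

Lemma le_prop b s s' : s <= s' -> (prop b <= s%:E)%E -> (prop b <= s'%:E)%E.
Proof. by move=> ss' h; apply: le_trans h _; rewrite lee_fin. Qed.

Lemma prop_ltyP b : (prop b < +oo)%E <-> exists2 s, 0 < s & (prop b <= s%:E)%E.
Proof.
split=> [|[s _ h]]; last by apply: le_lt_trans h _; rewrite ltry.
(* When all entries of [b] vanish, [prop b] is [-oo] and any positive bound serves. *)
case E : (prop b) => [r| |]// _; last by exists 1; rewrite // leNye.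
exists (Num.max r 1); first by rewrite lt_max ltr01 orbT.
by rewrite lee_fin le_max lexx.
Qed.

Lemma uniform_roeP p : uniform_roe p <-> forall e : R, 0 < e ->
  exists b s, [/\ 0 < s, (prop b <= s%:E)%E &
    forall xi, l2norm (p xi - b xi) <= e * l2norm xi].
Proof.
rewrite /uniform_roe; split=> [/closure_BopP h e e0|h].
  have [b /prop_ltyP[s s0 bs] be] := h _ e0; exists b, s; split => // xi.
  by rewrite -BopB; exact: l2norm_Bop_bound.
apply/closure_BopP => e e0; have [b [s [s0 bs be]]] := h _ e0.
exists b; first by apply/prop_ltyP; exists s.
by apply: opnorm_le_bound; [exact: ltW|exact: be].
Qed.

Lemma uniform_roe_prop b s : (prop b <= s%:E)%E -> uniform_roe b.
Proof.
move=> bs; apply/uniform_roeP => e e0; exists b, (Num.max s 1); split.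
- by rewrite lt_max ltr01 orbT.
- by apply: le_prop bs; rewrite le_max lexx.
- by move=> xi; rewrite subrr l2norm0 mulr_ge0 ?(ltW e0)// l2norm_ge0.
Qed.

Definition compress A b : Bop R X := compB (chi A) (compB b (chi A)).

Lemma compressE A b xi : compress A b xi = chi A (b (chi A xi)). Proof. by []. Qed.

Lemma compress_chil A b xi : chi A (compress A b xi) = compress A b xi.
Proof. by rewrite compressE chi_idem. Qed.

Lemma compress_chir A b xi : compress A b (chi A xi) = compress A b xi.
Proof. by rewrite !compressE chi_idem. Qed.

Lemma compress_prop A b s : (prop b <= s%:E)%E -> (prop (compress A b) <= s%:E)%E.
Proof.
move=> /propP bs; apply/propP => x y; rewrite compressE.
have [Ay|Ay] := pselect (A y); last by rewrite chi_out// eqxx.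
rewrite chi_in// chi_delta; case: ifP => [_|_]; first exact: bs.
by rewrite linear0 eqxx.
Qed.

Lemma supported_prop q F : finite_set F -> (forall xi, chi F (q xi) = q xi) ->
  (forall xi, q (chi F xi) = q xi) -> exists2 s, 0 < s & (prop q <= s%:E)%E.
Proof.
move=> fF Fq qF.
have [M M0 MP] := finite_set_real_ub (fun u : X * X => mdist u.1 u.2) (finite_setX fF fF).
exists M => //; apply/propP => x y; rewrite -Fq -qF.
have [Fy|Fy] := pselect (F y); last by rewrite chi_out// eqxx.
have [Fx _|Fx] := pselect (F x); first exact: (MP (x, y)).
rewrite chi_delta memNset// linear0 chi_eq0 ?eqxx//.
Qed.

Lemma prop_support b s F xi y : (prop b <= s%:E)%E -> finite_set F ->
  (forall x, F x -> s < mdist x y) -> b (chi F xi) y = 0.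
Proof.
move=> /propP bs /(@finite_set_enum R)[m [x [_ FE ->]]] sF.
rewrite Bopv_sum ell2_sum big1 => [//|i _]; rewrite BopvZ ell2Z.
have [->|/bs] := eqVneq (b (delta (x i)) y) 0; first by rewrite mulr0.
have /sF : F (x i) by rewrite FE; exists i.
by rewrite ltNge => /negP + h => /(_ h).
Qed.

(** Approximants for large [n] suffice: each of the finitely many remaining [q n] lives on a finite
    set and is its own approximant of finite propagation. Compression to [F n] keeps the error and
    the propagation bound and makes the approximants block-supported. *)
Lemma equi_tail (F : nat -> set X) (q : nat -> Bop R X) :
  (forall n, finite_set (F n)) ->
  (forall n xi, chi (F n) (q n xi) = q n xi) ->
  (forall n xi, q n (chi (F n) xi) = q n xi) ->
  (forall e : R, 0 < e -> exists K s, forall n, (K <= n)%N ->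
    exists2 b, (prop b <= s%:E)%E &
      forall xi, l2norm (q n xi - b xi) <= e * l2norm xi) ->
  forall e : R, 0 < e -> exists2 s, 0 < s & forall n,
    exists b, [/\ (prop b <= s%:E)%E, forall xi, chi (F n) (b xi) = b xi,
      forall xi, b (chi (F n) xi) = b xi &
      forall xi, l2norm (q n xi - b xi) <= e * l2norm xi].
Proof.
move=> fF Fq qF h e e0; have [K [s sP]] := h e e0.
have /choice[t tP] : forall n, exists t, (prop (q n) <= t%:E)%E.
  by move=> n; have [t _ tP] := supported_prop (fF n) (Fq n) (qF n); exists t.
have [M M0 MP] := finite_set_real_ub t (finite_II K).
exists (Num.max s M); first by rewrite lt_max M0 orbT.
move=> n; case: (ltnP n K) => nK.
  exists (q n); split => //.
    by apply: le_prop (tP n); rewrite le_max MP ?orbT.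
  by move=> xi; rewrite subrr l2norm0 mulr_ge0 ?(ltW e0)// l2norm_ge0.
have [b bs be] := sP n nK; exists (compress (F n) b); split.
- by apply: le_prop (compress_prop _ bs); rewrite le_max lexx.
- exact: compress_chil.
- exact: compress_chir.
- move=> xi; rewrite -Fq -qF compressE -linearB.
  apply: le_trans (chi_le _ _) _; apply: le_trans (be _) _.
  by rewrite ler_wpM2l ?(ltW e0)// chi_le.
Qed.

Context (X_ulf : uniformly_locally_finite X).

Lemma finite_nbhd B s : finite_set B ->
  finite_set [set y | exists2 x, B x & mdist x y <= s].
Proof.
(* Balls are open and the radius must be positive, whereas [s] is an arbitrary real and the
   inequality is weak. *)
move=> fB; pose r := Num.max s 0 + 1.
have r0 : 0 < r by rewrite ltr_wpDl// le_max lexx orbT.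
have [N NP] := X_ulf r0.
apply: (@sub_finite_set _ _ (\bigcup_(x in B) ball x r)).
  move=> y [x Bx xy]; exists x => //; rewrite ballEmdist/=.
  by apply: le_lt_trans xy _; rewrite /r ltr_pwDr// le_max lexx.
by apply: bigcup_finite => // x _; apply/finite_set_leP; exists N.
Qed.

Lemma card_le_enum (T : choiceType) (A : set T) N m (x : 'I_m -> T) :
  injective x -> A = range x -> (A #<= `I_N)%card -> (m <= N)%N.
Proof.
move=> xI AE AN; rewrite -card_le_II; apply: card_le_trans AN.
rewrite AE (card_le_eql (@card_II m)) (card_le_eqr (inj_card_eq _)) ?card_lexx//.
by move=> i j _ _; exact: xI.
Qed.

(** The support lies in a single ball, so [xi] combines at most [N] basis vectors, with coefficients
    of modulus at most 1. *)
Lemma localised_vector_bound q xi s N (c : R) : 0 <= c ->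
  (forall x : X, (ball x s #<= `I_N)%card) -> l2norm xi = 1 ->
  (forall x y, supp xi x -> supp xi y -> mdist x y < s) ->
  (forall x, l2norm (q (delta x)) <= c) -> l2norm (q xi) <= N%:R * c.
Proof.
move=> c0 NP x1 xs qc.
have [z xz] : exists z, supp xi z.
  apply: contrapT => h; have x0 : xi = 0.
    apply: ell2P_eq => z; apply/eqP; apply/negPn/negP => xz; apply: h.
    by exists z.
  by move: x1; rewrite x0 l2norm0 => /esym/eqP; rewrite oner_eq0.
have fB : finite_set (ball z s) by apply/finite_set_leP; exists N.
have [m [x [xI BE chiB]]] := @finite_set_enum R _ _ fB.
have mN : (m <= N)%N by exact: card_le_enum xI BE (NP z).
have xB : chi (ball z s) xi = xi.
  apply: chi_id => y nB; apply/eqP; apply/negPn/negP => xy; apply: nB.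
  by rewrite ballEmdist; exact: xs.
rewrite -xB chiB Bopv_sum; apply: le_trans (ler_l2norm_sum _ _ _) _.
apply: (@le_trans _ _ (\sum_(i < m) c)).
  apply: ler_sum => i _; rewrite BopvZ l2normZ -[leRHS]mul1r.
  apply: ler_pM => //; [exact: normc_ge0|exact: l2norm_ge0|].
  by rewrite -x1; exact: normc_le_l2norm.
by rewrite sumr_const card_ord -[c *+ m]mulr_natl ler_wpM2r// ler_nat.
Qed.

End metric_lemmas.

(** * Passage to a subset *)

Section subspace.
Context {R : realType} {X : metricType R} (A : set X).
Local Notation H := (ell2 R X).
Local Notation HA := (ell2 R A).
Implicit Types (xi : HA) (eta : H).

Lemma set_valP (y : A) : A (\val y).
Proof. by rewrite -in_setE; exact: valP. Qed.

Lemma esum_val (f : X -> \bar R) : (forall x, 0 <= f x)%E ->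
  (forall x, ~ A x -> f x = 0)%E ->
  (\esum_(x in [set: X]) f x = \esum_(y in [set: A]) f (\val y))%E.
Proof.
move=> f0 fA.
rewrite (esumID A)// [X in (_ + X)%E]esum1 ?adde0 => [|x [_ /fA]//].
rewrite setTI; apply: (@reindex_esum R A X [set: A] A (fun y => \val y)) => //.
split=> [y _|y z _ _|x Ax]; [exact: set_valP|exact: val_inj|].
have Ax' : x \in A by rewrite in_setE.
by exists (Sub x Ax').
Qed.

Definition extend_fun (f : A -> R[i]) (x : X) : R[i] :=
  if insub x is Some y then f y else 0.

Lemma extend_fun_val f (y : A) : extend_fun f (\val y) = f y.
Proof. by rewrite /extend_fun valK. Qed.

Lemma extend_fun_out f x : ~ A x -> extend_fun f x = 0.
Proof. by move=> Ax; rewrite /extend_fun insubN// memNset. Qed.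

Lemma sqsum_extend f : sqsum (extend_fun f) = sqsum f.
Proof.
rewrite /sqsum esum_val.
- by apply: eq_esum => y _; rewrite extend_fun_val.
- by move=> x; rewrite lee_fin sqr_ge0.
- by move=> x Ax; rewrite extend_fun_out// normc0 expr0n.
Qed.

Lemma extend_subproof xi : extend_fun xi \in sqsummable.
Proof. by rewrite inE/= sqsum_extend; have := ell2P xi; rewrite inE. Qed.

Definition extend xi : H := Ell2 (extend_subproof xi).

Lemma extendE xi y : extend xi (\val y) = xi y.
Proof. exact: extend_fun_val. Qed.

Lemma extend_out xi x : ~ A x -> extend xi x = 0.
Proof. exact: extend_fun_out. Qed.

Lemma l2norm_extend xi : l2norm (extend xi) = l2norm xi.
Proof. by rewrite /l2norm sqsum_extend. Qed.

Lemma eq_extend eta xi : (forall x, ~ A x -> eta x = 0) ->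
  (forall y, eta (\val y) = xi y) -> extend xi = eta.
Proof.
move=> h1 h2; apply: ell2P_eq => x; have [Ax|Ax] := pselect (A x).
  have Ax' : x \in A by rewrite in_setE.
  by rewrite -[x](SubK A Ax') extendE h2.
by rewrite extend_out// h1.
Qed.

Lemma restrict_subproof eta : (fun y : A => eta (\val y)) \in sqsummable.
Proof.
have := ell2P (chi A eta); rewrite !inE/= {1}/sqsum esum_val.
- apply: le_lt_trans; apply: le_esum => y _.
  by rewrite mem_set//; exact: set_valP.
- by move=> x; rewrite lee_fin sqr_ge0.
- by move=> x Ax; rewrite memNset// normc0 expr0n.
Qed.

Definition restrict eta : HA := Ell2 (restrict_subproof eta).

Lemma restrictE eta y : restrict eta y = eta (\val y). Proof. by []. Qed.

Lemma extendK xi : restrict (extend xi) = xi.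
Proof. by apply: ell2P_eq => y; rewrite restrictE extendE. Qed.

Lemma restrictK eta : extend (restrict eta) = chi A eta.
Proof.
apply: eq_extend => [x|y]; first exact: chi_out.
by rewrite (chi_in _ (@set_valP y)).
Qed.

Lemma l2norm_restrict eta : l2norm (restrict eta) = l2norm (chi A eta).
Proof. by rewrite -restrictK l2norm_extend. Qed.

Lemma extend_linear : linear extend.
Proof.
move=> c xi xi'; apply: eq_extend => [x Ax|y].
  by rewrite ell2D ell2Z !extend_out// mulr0 addr0.
by rewrite !ell2D !ell2Z !extendE.
Qed.

Lemma restrict_linear : linear restrict.
Proof. by move=> c eta eta'; apply: ell2P_eq. Qed.

Lemma extendB xi xi' : extend (xi - xi') = extend xi - extend xi'.
Proof.
by rewrite addrC -scaleN1r extend_linear scaleN1r addrC.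
Qed.

Lemma restrictB eta eta' : restrict (eta - eta') = restrict eta - restrict eta'.
Proof. exact: ell2P_eq. Qed.

(** [extend] and [restrict] are adjoint to each other, which transports self-adjointness between the
    subset and the ambient space. *)
Lemma dot_extend xi eta : dot (extend xi) eta = dot xi (restrict eta).
Proof.
have rsum_val (g : X -> R) : (forall x, ~ A x -> g x = 0) ->
    rsum g = rsum (fun y : A => g (\val y)).
  move=> gA; rewrite /rsum (@esum_val (EFin \o g)^\+%E)//; last first.
    by move=> x /gA gx; rewrite funeposE /= gx maxxx.
  rewrite (@esum_val (EFin \o g)^\-%E)//; last first.
    by move=> x /gA gx; rewrite funenegE /= gx oppr0 maxxx.
  by congr (fine (_ - _)%E); apply: eq_esum => y _; rewrite ?funeposE ?funenegE.
rewrite /dot /csum !rsum_val; last 2 first.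
- by move=> x Ax; rewrite extend_out// mul0r.
- by move=> x Ax; rewrite extend_out// mul0r.
by congr (_ +i* _); congr rsum; apply/funext => y; rewrite extendE.
Qed.

Lemma extend_delta y : extend (delta y) = delta (\val y).
Proof.
apply: eq_extend => [x Ax|z]; rewrite !deltaE.
  by case: eqP => // xy; case: Ax; rewrite xy; exact: set_valP.
by rewrite (inj_eq val_inj).
Qed.

Lemma restrict_delta y : restrict (delta (\val y)) = delta y.
Proof. by rewrite -extend_delta extendK. Qed.

Lemma ext_op_subproof (p : Bop R A) :
  (fun eta => extend (p (restrict eta))) \in bounded_op.
Proof.
apply: mkBop_subproof => [c eta eta'|].
  by rewrite restrict_linear linearP extend_linear.
exists (opnorm p) => eta; rewrite l2norm_extend.
apply: le_trans (l2norm_Bop_le _ _) _.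
by rewrite ler_wpM2l ?opnorm_ge0// l2norm_restrict chi_le.
Qed.

Definition ext_op p : Bop R X := MkBop (ext_op_subproof p).

Lemma ext_opE p eta : ext_op p eta = extend (p (restrict eta)). Proof. by []. Qed.

Lemma res_op_subproof (p : Bop R X) :
  (fun xi => restrict (p (extend xi))) \in bounded_op.
Proof.
apply: mkBop_subproof => [c xi xi'|].
  by rewrite extend_linear linearP restrict_linear.
exists (opnorm p) => xi; rewrite l2norm_restrict -(l2norm_extend xi).
by apply: le_trans (chi_le _ _) _; exact: l2norm_Bop_le.
Qed.

Definition res_op p : Bop R A := MkBop (res_op_subproof p).

Lemma res_opE p xi : res_op p xi = restrict (p (extend xi)). Proof. by []. Qed.

Lemma ext_op_projection p : projection p -> projection (ext_op p).
Proof.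
move=> pp; split=> [eta eta'|eta]; last first.
  by rewrite !ext_opE extendK projection_idem.
rewrite !ext_opE dot_extend projection_self// [LHS]dotC -dot_extend.
by rewrite -dotC.
Qed.

Lemma ext_op_prop p s : (prop p <= s%:E)%E -> (prop (ext_op p) <= s%:E)%E.
Proof.
move=> /propP ps; apply/propP => x y; rewrite ext_opE.
have [Ay|Ay] := pselect (A y); last by rewrite extend_out// eqxx.
have Ay' : y \in A by rewrite in_setE.
rewrite -{1 2}[y](SubK A Ay') extendE.
have [Ax|Ax] := pselect (A x); last first.
  rewrite (_ : restrict _ = 0) ?linear0 ?eqxx//; apply: ell2P_eq => z.
  rewrite restrictE deltaE; case: eqP => // zx; case: Ax; rewrite -zx.
  exact: set_valP.
have Ax' : x \in A by rewrite in_setE.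
by rewrite -{1 2}[x](SubK A Ax') restrict_delta => /ps.
Qed.

Lemma ext_op_roe p : uniform_roe p -> uniform_roe (ext_op p).
Proof.
move=> /uniform_roeP h; apply/uniform_roeP => e e0.
have [b [s [s0 bs be]]] := h e e0; exists (ext_op b), s; split => //.
  exact: ext_op_prop.
move=> eta; rewrite !ext_opE -extendB l2norm_extend.
apply: le_trans (be _) _.
by rewrite ler_wpM2l ?(ltW e0)// l2norm_restrict chi_le.
Qed.

Lemma ext_op_ghost p : ghost p -> ghost (ext_op p).
Proof.
move=> h e e0; have [B [fB BP]] := h e e0.
exists [set \val y | y in B]; split; first exact: finite_image.
move=> x z Bx Bz; rewrite entryE ext_opE.
have [Ax|Ax] := pselect (A x); last by rewrite extend_out// normc0 ltW.
have [Az|Az] := pselect (A z); last first.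
  rewrite (_ : restrict _ = 0); last first.
    apply: ell2P_eq => y; rewrite restrictE deltaE; case: eqP => // yz.
    by case: Az; rewrite -yz; exact: set_valP.
  rewrite linear0 (_ : extend 0 = 0) ?normc0 ?(ltW e0)//.
  by apply: eq_extend.
have Ax' : x \in A by rewrite in_setE.
have Az' : z \in A by rewrite in_setE.
rewrite -[x](SubK A Ax') -[z](SubK A Az') extendE restrict_delta -entryE.
apply: BP => By; [apply: Bx|apply: Bz]; [exists (Sub x Ax')|exists (Sub z Az')] => //.
Qed.

Lemma res_op_prop p s : (prop p <= s%:E)%E -> (prop (res_op p) <= s%:E)%E.
Proof.
move=> /propP ps; apply/propP => x y.
by rewrite res_opE restrictE extend_delta => /ps.
Qed.

Lemma res_op_roe p : uniform_roe p -> uniform_roe (res_op p).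
Proof.
move=> /uniform_roeP h; apply/uniform_roeP => e e0.
have [b [s [s0 bs be]]] := h e e0; exists (res_op b), s; split => //.
  exact: res_op_prop.
move=> xi; rewrite !res_opE -restrictB l2norm_restrict -(l2norm_extend xi).
by apply: le_trans (chi_le _ _) _; exact: be.
Qed.

Lemma res_op_ghost p : ghost p -> ghost (res_op p).
Proof.
move=> h e e0; have [B [fB BP]] := h e e0.
exists [set y | B (\val y)]; split.
  by apply: (finite_preimage _ fB) => y z _ _; exact: val_inj.
move=> y z By Bz; rewrite entryE res_opE restrictE extend_delta -entryE.
exact: BP.
Qed.

(** The condition says that [p] maps vectors supported on [A] to such vectors, so the cut-off
    [chi A] between the two factors of [p] has no effect. *)
Lemma res_op_projection p : projection p ->
  (forall xi x, ~ A x -> p (extend xi) x = 0) -> projection (res_op p).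
Proof.
move=> pp pA; split=> [xi xi'|xi]; rewrite !res_opE.
  by rewrite -dot_extend -(projection_self pp) [RHS]dotC dot_extend -dotC.
by rewrite restrictK chi_id ?projection_idem// => x; exact: pA.
Qed.

End subspace.

(** * Ghost projections on sparse sets *)

Lemma chi_compl_chi (R : realType) (X : choiceType) (A : set X) (xi : ell2 R X) :
  chi (~` A) (chi A xi) = 0.
Proof. by rewrite chiI setICl chi_eq0. Qed.

Section sparse_ghosts.
Context {R : realType} {X : metricType R}.
Local Notation H := (ell2 R X).
Implicit Types (xi eta : H) (p q b : Bop R X).

Context (F : nat -> set X) (tF : trivIset [set: nat] F).
Context (fF : forall n, finite_set (F n)).
Context (sF : forall r : R, exists N : nat, forall n m : nat,
  n != m -> (N <= n + m)%N -> (r%:E < set_dist (F n) (F m))%E).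
Context (p : Bop R X) (pp : projection p) (proe : uniform_roe p) (pg : ghost p).
Local Notation U := (\bigcup_n F n).
Local Notation G K := (\bigcup_(n in `I_K) F n).
Context (Up : forall xi, chi U (p xi) = p xi).
Context (pU : forall xi, p (chi U xi) = p xi).

(** For large [n] every other block is farther than [s] from [F n], so [b] cannot carry mass from
    [F n] to another block. *)
Lemma propagation_block b s : (prop b <= s%:E)%E ->
  exists N, forall n, (N <= n)%N -> forall xi,
    chi U (b (chi (F n) xi)) = chi (F n) (b (chi (F n) xi)).
Proof.
move=> bs; have [N NP] := sF s; exists N => n Nn xi; apply: ell2P_eq => y.
have [Fy|Fy] := pselect (F n y); first by rewrite !chi_in//; exists n.
rewrite [RHS]chi_out//; have [[m _ Fm]|Uy] := pselect (U y); last by rewrite chi_out.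
rewrite chi_in; last by exists m.
apply: (prop_support _ bs) => // x Fx.
have nm : n != m by apply/eqP => nm; apply: Fy; rewrite nm.
apply: (lt_set_dist (NP n m nm _)) => //.
exact: leq_trans (leq_addr _ _).
Qed.

Lemma off_diagonal_small (e : R) : 0 < e -> exists N, forall n, (N <= n)%N ->
  forall xi, l2norm (p (chi (F n) xi) - compress (F n) p xi) <= e * l2norm xi.
Proof.
move=> e0; have /uniform_roeP/(_ e e0)[b [s [_ bs be]]] := proe.
have [N NP] := propagation_block bs; exists N => n Nn xi.
rewrite compressE chi_complB -Up.
(* Inside [U], [b] does not leave [F n]; subtracting it is free and leaves only the approximation
   error. *)
have -> : chi (~` F n) (chi U (p (chi (F n) xi))) =
    chi (~` F n) (chi U (p (chi (F n) xi) - b (chi (F n) xi))).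
  by rewrite !BopvB (NP _ Nn) chi_compl_chi subr0.
apply: le_trans (chi_le _ _) _; apply: le_trans (chi_le _ _) _.
by apply: le_trans (be _) _; rewrite ler_wpM2l ?(ltW e0)// chi_le.
Qed.

Let T n := compress (F n) p.

Lemma compress_self n xi eta : dot (T n xi) eta = dot xi (T n eta).
Proof. by rewrite !compressE chi_self projection_self// chi_self. Qed.

Lemma rounded_blocks : exists q : nat -> Bop R X, [/\
  forall n, projection (q n), forall n xi, chi (F n) (q n xi) = q n xi,
  forall n xi, q n (chi (F n) xi) = q n xi &
  forall e : R, 0 < e -> exists N, forall n, (N <= n)%N -> forall xi,
    l2norm (q n xi - T n xi) <= e * l2norm xi].
Proof.
(* Rounding is applied in every block, with [d] the norm of the defect [T n] squared minus [T n].
   That this defect tends to 0 is shown afterwards. *)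
have /choice[q qP] n := almost_projection (fF n) (opnorm_ge0 (compB (T n) (T n) - T n))
  (@compress_self n) (@compress_chil _ _ (F n) p) (@compress_chir _ _ (F n) p)
  (@l2norm_Bop_le _ _ (compB (T n) (T n) - T n)).
exists q; split => [n|n|n|e e0]; [by case: (qP n)..|].
have e2 : 0 < e / 2 by rewrite divr_gt0.
have [N NP] := off_diagonal_small e2; exists N => n Nn xi.
have [_ _ _ h] := qP n; apply: le_trans (h xi) _.
rewrite ler_wpM2r ?l2norm_ge0// -ler_pdivlMl// mulrC.
apply: opnorm_le_bound => [|eta]; first exact: ltW.
(* Idempotence of [p] expresses the defect through the off-diagonal part of [p] on [F n]. *)
have -> : (compB (T n) (T n) - T n) eta =
    chi (F n) (p (T n eta - p (chi (F n) eta))).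
  rewrite BopB compBE (BopvB p) (projection_idem pp) (BopvB (chi _)).
  by rewrite [T n (T n eta)]compressE compress_chil.
apply: le_trans (chi_le _ _) _; apply: le_trans (projection_le pp _) _.
by rewrite l2normBC; exact: NP.
Qed.

(** The diagonal entry at [x] is the squared column norm, hence the ghost condition for [c ^+ 2].
    The exceptional finite set meets only finitely many blocks. *)
Lemma ghost_delta_small (c : R) : 0 < c -> exists N, forall n, (N <= n)%N ->
  forall x, F n x -> l2norm (p (delta x)) <= c.
Proof.
move=> c0; have [A [fA AP]] := pg (exprn_gt0 2 c0).
have [N NP] := finite_in_partial F fA; exists N => n Nn x Fx.
rewrite -ler_sqr ?nnegrE ?l2norm_ge0 ?(ltW c0)// -projection_delta_sqr//.
have nA : ~ A x.
  move=> Ax; have [|m mN Fm] := NP x Ax; first by exists n.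
  have mn := block_index_uniq tF Fm Fx; have := leq_trans mN Nn.
  by rewrite mn ltnn.
exact: AP.
Qed.

Context (X_ulf : uniformly_locally_finite X).
Context (onl : ONL_finite_rank_projections X).

(** ONL gives each non-zero [q n] a unit vector of uniformly bounded support on which its norm is at
    least 1/2. Small columns forbid this for large [n], so [q n = 0], and on [F n] the operator [p]
    is close to [T n], which is close to [q n]. *)
Lemma blocks_vanish (e : R) : 0 < e -> exists N, forall n, (N <= n)%N ->
  forall xi, l2norm (p (chi (F n) xi)) <= e * l2norm xi.
Proof.
move=> e0.
have [q [qp Fq qF qT]] := rounded_blocks.
have qtail e' : 0 < e' -> exists K s, forall n, (K <= n)%N ->
    exists2 b, (prop b <= s%:E)%E &
      forall xi, l2norm (q n xi - b xi) <= e' * l2norm xi.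
  move=> e'0; have e2 : 0 < e' / 2 by rewrite divr_gt0.
  have /uniform_roeP/(_ _ e2)[b [s [_ bs be]]] := proe.
  have [K KP] := qT _ e2; exists K, s => n Kn.
  exists (compress (F n) b); first exact: compress_prop.
  move=> xi; apply: le_trans (ler_l2dist (T n xi) _ _) _.
  rewrite [e']splitr mulrDl; apply: lerD; first exact: KP.
  rewrite !compressE -BopvB; apply: le_trans (chi_le _ _) _.
  by apply: le_trans (be _) _; rewrite ler_wpM2l ?(ltW e2)// chi_le.
have qequi := equi_tail fF Fq qF qtail.
pose S := [set q n | n in [set: nat]].
have S_roe : S `<=` uniform_roe.
  move=> _ [n _ <-]; have [s _ sP] := supported_prop (fF n) (Fq n) (qF n).
  exact: uniform_roe_prop sP.
have S_equi : equi_approximable S.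
  move=> e' e'0; have [s s0 sP] := qequi _ e'0; exists s => // _ [n _ <-].
  have [b [bs _ _ be]] := sP n; exists b; split => //.
  by apply: opnorm_le_bound; [exact: ltW|exact: be].
have S_fr a : S a -> projection a /\ finite_rank a.
  move=> [n _ <-]; split; first exact: qp.
  exact: supported_finite_rank (fF n) (Fq n).
have h2 : 0 < (1 / 2 : R) by rewrite divr_gt0.
have [s s0 sP] := onl h2 S_roe S_equi S_fr.
(* Supports of diameter at most [s] fit into open balls of radius [s + 1]. *)
have s10 : 0 < s + 1 by rewrite ltr_wpDl// ltW.
have [M MP] := X_ulf s10.
have M0 : 0 < (M.+1%:R : R) by rewrite ltr0n.
(* With at most [M] points in a ball, columns of norm [c] give at most 1/4, below the 1/2 promised
   by ONL. The denominator [M.+1] is never zero. *)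
pose c : R := 1 / 4 / M.+1%:R.
have c0 : 0 < c by rewrite !divr_gt0.
have c2 : 0 < c / 2 by rewrite divr_gt0.
have [N1 N1P] := ghost_delta_small c2.
have [N2 N2P] := qT _ c2.
have qd n : (maxn N1 N2 <= n)%N -> forall x, l2norm (q n (delta x)) <= c.
  rewrite geq_max => /andP[n1 n2] x.
  have [Fx|Fx] := pselect (F n x); last first.
    by rewrite -qF chi_delta memNset// linear0 l2norm0 ltW.
  rewrite -[q n _](subrK (T n (delta x))); apply: le_trans (ler_l2normD _ _) _.
  rewrite [c]splitr; apply: lerD.
    by apply: le_trans (N2P _ n2 _) _; rewrite l2norm_delta mulr1.
  rewrite compressE chi_delta mem_set//.
  by apply: le_trans (chi_le _ _) _; exact: (N1P n n1 x Fx).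
have q0 n : (maxn N1 N2 <= n)%N -> q n = 0.
  move=> hn; apply/eqP/negPn/negP => qn0.
  have [|xi [xi1 /diamP xis]] := sP (q n); first by exists n.
  rewrite projection_opnorm1// => hq.
  have : l2norm (q n xi) <= M%:R * c.
    apply: (localised_vector_bound (ltW c0) MP xi1); last exact: qd.
    by move=> x y sx sy; apply: le_lt_trans (xis _ _ sx sy) _; rewrite ltrDl.
  have : M%:R * c <= 1 / 4.
    rewrite /c mulrA ler_pdivrMr// mulrC; apply: ler_wpM2l; last by rewrite ler_nat.
    by rewrite divr_ge0.
  move: hq; move: (l2norm _) (M%:R * c) => u v; lra.
have e2 : 0 < e / 2 by rewrite divr_gt0.
have [N3 N3P] := qT _ e2; have [N4 N4P] := off_diagonal_small e2.
exists (maxn (maxn N1 N2) (maxn N3 N4)) => n.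
rewrite geq_max => /andP[n12]; rewrite geq_max => /andP[n3 n4] xi.
rewrite -[p _](subrK (T n xi)); apply: le_trans (ler_l2normD _ _) _.
rewrite [e]splitr mulrDl; apply: lerD; first exact: N4P.
by have := N3P n n3 xi; rewrite q0// sub0r l2normN.
Qed.

(** Each late block is almost annihilated, but the errors must not add up over infinitely many
    blocks. Replacing [p] by the finite-propagation [b], block diagonal far out, makes the pieces
    orthogonal, so one constant bounds their sum. *)
Lemma sparse_ghost_localised : exists2 A, finite_set A &
  forall xi, l2norm (p xi - chi A (p xi)) <= 1 / 2 * l2norm xi.
Proof.
pose e : R := 1 / 8.
have e0 : 0 < e by rewrite divr_gt0.
have /uniform_roeP/(_ e e0)[b [s [_ bs be]]] := proe.
have [N1 N1P] := propagation_block bs; have [N2 N2P] := blocks_vanish e0.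
pose N := maxn N1 N2.
exists (G N); first by apply: bigcup_finite => //; exact: finite_II.
have key xi : l2norm (p xi - p (chi (G N) xi)) <= 1 / 2 * l2norm xi.
  pose z := chi (U `\` G N) xi.
  have zx : l2norm z <= l2norm xi by exact: chi_le.
  have -> : p xi - p (chi (G N) xi) = p z.
    rewrite -[p xi]pU -BopvB; congr (p _); apply: ell2P_eq => x.
    rewrite ell2B /z !chiE in_setD; case: (boolP (x \in G N)).
      rewrite in_setE andbF => -[n _ Fn].
      by rewrite mem_set ?subrr//; exists n.
    by rewrite subr0 andbT.
  (* One [e] pays for replacing [p] by [b]. On each late block [b] is within [e] of [p], which is
     itself bounded by [e]; this gives the other [2 * e]. With [e = 1 / 8] the total stays below
     1/2. *)
  have fb K : l2norm (p (chi (G K) z)) <= 3 * e * l2norm xi.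
    rewrite -Up -[p _](subrK (b (chi (G K) z))) BopvD.
    apply: le_trans (ler_l2normD _ _) _.
    have -> : 3 * e * l2norm xi = e * l2norm xi + 2 * e * l2norm xi by ring.
    apply: lerD.
      apply: le_trans (chi_le _ _) _; apply: le_trans (be _) _.
      by rewrite ler_wpM2l ?(ltW e0)//; apply: le_trans (chi_le _ _) _.
    rewrite chi_partial// !Bopv_sum.
    pose v n := chi (F n) (chi U (b (chi (F n) z))).
    have zsmall n : (n < N)%N -> chi (F n) z = 0.
      move=> nN; rewrite /z chiI chi_eq0// => x [Fx [_ nG]].
      by case: nG; exists n.
    rewrite (eq_bigr (fun n : 'I_K => v n)) => [|n _]; last first.
      rewrite /v; case: (ltnP n N) => nN; first by rewrite zsmall// !linear0.
      rewrite N1P; first by rewrite chi_idem.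
      by apply: leq_trans nN; exact: leq_maxl.
    apply: le_trans (_ : _ <= 2 * e * l2norm z) _; last first.
      by rewrite ler_wpM2l// mulr_ge0// ltW.
    apply: (block_sum_le tF); first by rewrite mulr_ge0// ltW.
      by move=> n; exact: chi_idem.
    move=> n; case: (ltnP n N) => nN.
      by rewrite /v zsmall// !linear0 l2norm0 mulr0.
    apply: le_trans (chi_le _ _) _; apply: le_trans (chi_le _ _) _.
    rewrite -[b _](subrK (p (chi (F n) z))); apply: le_trans (ler_l2normD _ _) _.
    rewrite mulr2n mulrDl mul1r mulrDl; apply: lerD; first by rewrite l2normBC be.
    have := N2P n (leq_trans (leq_maxr _ _) nN) (chi (F n) z).
    by rewrite chi_idem.
  apply: (@le_trans _ _ (3 * e * l2norm xi)); last first.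
    by rewrite ler_wpM2r ?l2norm_ge0// /e; lra.
  (* The bound [fb] concerns finitely many blocks at a time; the remaining tail of [z] is made
     smaller than [d]. *)
  apply/ler_addgt0Pr => d d0.
  have zU x : ~ U x -> z x = 0 by move=> Ux; rewrite chi_out// => -[].
  have [K /(_ K (leqnn K)) KP] := block_tail zU d0.
  rewrite -[z](subrK (chi (G K) z)) BopvD addrC.
  apply: le_trans (ler_l2normD _ _) _; apply: lerD; first exact: fb.
  exact: le_trans (projection_le pp _) KP.
(* The estimate [key] cuts off before [p]; passing to adjoints puts the cut-off after it. *)
apply: (@adjoint_bound _ _ _ (fun xi => p xi - p (chi (G N) xi))) => // xi eta.
by rewrite dotBl dotBr chi_self !(projection_self pp).
Qed.

End sparse_ghosts.

(** ONL is available on [X] only, so the projection is extended by zero, localised there, and the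
    finite set pulled back to the sparse subset. *)
Lemma ONL_sparse_ghost_compact (R : realType) (X : metricType R) :
  uniformly_locally_finite X -> ONL_finite_rank_projections X ->
  forall A : set X, sparse A ->
  forall p : Bop R A, ghost_projection p -> compact_op p.
Proof.
move=> X_ulf onl A [F [AE tF fF sF]] p [proe pp pg].
have U_out xi x : ~ (\bigcup_n F n) x -> ext_op p xi x = 0.
  by rewrite -AE => Ax; rewrite ext_opE extend_out.
have [||B fB Bp] := sparse_ghost_localised tF fF sF (ext_op_projection pp)
    (ext_op_roe proe) (ext_op_ghost pg) _ _ X_ulf onl.
- by move=> xi; apply: chi_id => x; exact: U_out.
- by move=> xi; rewrite !ext_opE -AE -{1}[chi A xi]restrictK extendK.
apply: (@localised_compact _ _ p [set y | B (\val y)] (1 / 2)) => //.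
- by lra.
- by apply: (finite_preimage _ fB) => y z _ _; exact: val_inj.
move=> xi; have := Bp (extend xi); rewrite ext_opE extendK l2norm_extend.
rewrite -(l2norm_extend (p xi - _)) extendB.
suff -> : extend (chi [set y | B (\val y)] (p xi)) = chi B (extend (p xi)) by [].
apply: eq_extend => [x Ax|y]; first by rewrite chiE extend_out// if_same.
have [By|By] := pselect (B (\val y)); last by rewrite !chi_out.
by rewrite !chi_in// extendE.
Qed.

(** * Block ghost projections from the failure of ONL *)

Section orthogonal_sequences.
Context {R : realType} {X : choiceType}.
Implicit Types (xi : ell2 R X) (p q : Bop R X) (F : set X).

Lemma projection_fixed_unit q : projection q -> q != 0 ->
  exists xi, l2norm xi = 1 /\ q xi = xi.
Proof.
move=> qp /projection_neq0_vec[xi /unit_normalize[r r0 r1]].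
by exists (r%:C *: q xi); rewrite BopvZ projection_idem.
Qed.

Lemma orthogonal_unit_dist xi eta : l2norm xi = 1 -> l2norm eta = 1 ->
  dot xi eta = 0 -> 1 <= l2norm (xi - eta :> ell2 R X).
Proof.
move=> x1 e1 o; rewrite -ler_sqr ?nnegrE ?l2norm_ge0//.
by rewrite pythagoras ?dotNr ?o ?oppr0// l2normN x1 e1 expr1n lerDl.
Qed.

End orthogonal_sequences.

Section not_ONL.
Context {R : realType} {X : metricType R}.
Local Notation H := (ell2 R X).
Implicit Types (xi eta : H) (a p q b : Bop R X) (F B : set X).

(** The failure of the ONL inequality at scale [s] for a single operator. *)
Definition spread_out (e s : R) a : Prop :=
  forall xi, l2norm xi = 1 -> (diam (supp xi) <= s%:E)%E ->
    l2norm (a xi) < (1 - e) * opnorm a.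

Context (S : set (Bop R X)) (e : R) (e0 : 0 < e) (e1 : e <= 1).
Context (Sp : forall a, S a -> projection a).
Context (Sf : forall a, S a -> finite_rank a).
Context (Se : equi_approximable S).

(* If [a] moved [delta x] substantially, a localised approximation of
   [a (delta x)] would be a localised almost fixed vector of [a]. *)
Lemma spread_out_delta_small (c : R) : 0 < c -> exists2 s, 0 < s &
  forall a, S a -> spread_out e s a -> forall x, l2norm (a (delta x)) <= c.
Proof.
(* The localised vector [v] has norm above [c - d >= 3 / 4 * c], and [a] shortens it by at most
   [2 * d]. This relative loss is at most [2 / 3 * e], less than the allowed [e]. *)
move=> c0; pose d := c * e / 4.
have d0 : 0 < d by rewrite !mulr_gt0// invr_gt0.
(* [b (delta x)] is supported within distance [s] of [x], hence on a set of diameter at most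
   [2 * s]. *)
have [s s0 sP] := Se d0; exists (2 * s); first by rewrite mulr_gt0.
move=> a Sa aspread x; rewrite leNgt; apply/negP => ac.
have [b [/propP bs be]] := sP a Sa.
have ap := Sp Sa.
pose v := b (delta x).
have va : l2norm (a (delta x) - v) <= d.
  rewrite -BopB; apply: le_trans (l2norm_Bop_bound _ be) _.
  by rewrite l2norm_delta mulr1.
have vc : c - d < l2norm v.
  have := ler_l2norm_sub (a (delta x)) v; lra.
have dc : d <= c / 4 by rewrite /d ler_wpM2r ?invr_ge0// ler_piMr// ltW.
have v0 : v != 0.
  by apply/eqP => v0; move: vc; rewrite v0 l2norm0; lra.
have [r r0 r1] := unit_normalize v0.
have rv : r * l2norm v = 1 by rewrite -r1 l2normZ normc_real gtr0_norm.
have vsupp : (diam (supp (r%:C *: v)) <= (2 * s)%:E)%E.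
  apply/diamP => y z; rewrite /supp/= => hy hz.
  have xs w : r%:C * v w != 0 -> mdist x w <= s.
    by rewrite mulf_eq0 negb_or => /andP[_]; exact: bs.
  apply: le_trans (metric_triangle y x z) _.
  by rewrite metric_sym mulr2n mulrDl mul1r lerD// xs.
have := aspread _ r1 vsupp; apply/negP; rewrite -leNgt.
have h1 : (1 - e) * opnorm a <= 1 - e.
  by rewrite -[leRHS]mulr1 ler_wpM2l ?subr_ge0// projection_opnorm_le1.
apply: le_trans h1 _.
rewrite BopvZ l2normZ normc_real gtr0_norm//.
have av : l2norm v - 2 * d <= l2norm (a v).
  have h2 := ler_l2dist (a (delta x)) v (a v).
  have h3 : l2norm (a (delta x) - a v) <= d.
    rewrite -[a (delta x)](projection_idem ap) -BopvB.
    by apply: le_trans (projection_le ap _) _.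
  have h4 : l2norm (v - a (delta x)) <= d by rewrite l2normBC.
  have h5 := ler_l2norm_sub v (a v); lra.
have h6 : r * (l2norm v - 2 * d) <= r * l2norm (a v) by rewrite ler_wpM2l// ltW.
apply: le_trans h6; rewrite mulrBr rv lerD2l lerN2.
have h7 : r * (3 / 4 * c) <= 1.
  by rewrite -[leRHS]rv ler_wpM2l ?(ltW r0)//; lra.
have -> : r * (2 * d) = (r * (3 / 4 * c)) * (2 / 3 * e) by rewrite /d; field.
have e23 : 0 <= 2 / 3 * e by rewrite mulr_ge0 ?divr_ge0// ltW.
apply: (@le_trans _ _ (2 / 3 * e)); first by rewrite ler_piMl.
by rewrite ler_piMl ?(ltW e0)// ler_pdivrMr// mul1r ler_nat.
Qed.

Context (Sbad : forall s : R, 0 < s -> exists2 a, S a & spread_out e s a).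
Context (X_neq0 : [set: X] !=set0).

(** For [a = 0] the strict inequality at some [delta x], whose support has diameter 0, would read 0
    < 0. *)
Lemma spread_out_neq0 s a : 0 < s -> spread_out e s a -> a != 0.
Proof.
move=> s0 h; apply/eqP => a0; have [x _] := X_neq0.
have /h : l2norm (delta x : H) = 1 by exact: l2norm_delta.
rewrite a0 Bop0 l2norm0 => /(_ _)/wrap[].
  apply/diamP => y z; rewrite /supp/=.
  have [->|_] := eqVneq y x; last by rewrite eqxx.
  have [->|_] := eqVneq z x; last by rewrite eqxx.
  by rewrite mdistxx ltW.
have -> : opnorm (0 : Bop R X) = 0.
  apply/eqP; rewrite eq_le opnorm_ge0 andbT; apply: opnorm_le_bound => // xi.
  by rewrite mul0r l2norm0.
by rewrite mulr0 ltxx.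
Qed.

Lemma chi_finite_bound (c : R) B : 0 < c -> finite_set B -> exists2 c', 0 < c' &
  forall a, (forall x, l2norm (a (delta x)) <= c') ->
    forall xi, l2norm (a (chi B xi)) <= c * l2norm xi.
Proof.
move=> c0 /(@finite_set_enum R)[m [x [_ _ chiB]]].
have m0 : 0 < (m.+1%:R : R) by rewrite ltr0n.
exists (c / m.+1%:R); first by rewrite divr_gt0.
move=> a ha xi; rewrite chiB Bopv_sum; apply: le_trans (ler_l2norm_sum _ _ _) _.
apply: (@le_trans _ _ (\sum_(i < m) l2norm xi * (c / m.+1%:R))).
  apply: ler_sum => i _; rewrite BopvZ l2normZ.
  by apply: ler_pM; [exact: normc_ge0|exact: l2norm_ge0|exact: normc_le_l2norm|].
rewrite sumr_const card_ord -mulrnAr mulrC ler_wpM2r ?l2norm_ge0//.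
rewrite -[_ *+ m]mulr_natr -mulrA ler_piMr ?(ltW c0)//.
by rewrite mulrC ler_pdivrMr// mul1r ler_nat.
Qed.

(** A sufficiently spread out [a] nearly annihilates the vectors on [B], and its finite rank nearly
    confines its range to a finite [F1]. Compressing to [F1] minus [B] gives an almost projection,
    which is rounded to [q]. *)
Lemma spread_out_step (d : R) B : 0 < d -> d < 1 -> finite_set B ->
  exists F a q, [/\ finite_set F /\ F !=set0, F `&` B = set0,
    [/\ projection q, q != 0, forall xi, chi F (q xi) = q xi &
      forall xi, q (chi F xi) = q xi],
    S a /\ (forall xi, l2norm (q xi - a xi) <= d * l2norm xi) &
    forall x, l2norm (q (delta x)) <= 2 * d].
Proof.
(* Compression costs [4 * c], and rounding the defect [2 * c] costs another [4 * c]; together they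
   make [d]. *)
move=> d0 d1 fB; pose c := d / 8.
have c0 : 0 < c by rewrite divr_gt0.
have [c' c'0 c'P] := chi_finite_bound c0 fB.
(* The bound [c'] controls [a] on [B]; the bound [d] controls the columns of [q] at the end. *)
have m0 : 0 < Num.min c' d by rewrite lt_min c'0.
have [s s0 sP] := spread_out_delta_small m0.
have [a Sa abad] := Sbad s0.
have ap := Sp Sa.
have adelta x : l2norm (a (delta x)) <= Num.min c' d by exact: sP.
have aB xi : l2norm (a (chi B xi)) <= c * l2norm xi.
  by apply: c'P => x; apply: le_trans (adelta x) _; rewrite ge_min lexx.
have Ba : forall xi, l2norm (chi B (a xi)) <= c * l2norm xi.
  apply: (@adjoint_bound _ _ _ (fun xi => a (chi B xi))) => // xi eta.
  by rewrite chi_self projection_self.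
have [F1 [fF1 F1P]] := finite_rank_tail c0 ap (Sf Sa).
pose F := F1 `\` B.
have fF : finite_set F by exact: finite_setD.
have aF xi : l2norm (a xi - chi F (a xi)) <= 2 * c * l2norm xi.
  have -> : a xi - chi F (a xi) =
      (a xi - chi F1 (a xi)) + chi F1 (chi B (a xi)).
    apply: ell2P_eq => x; rewrite [RHS]ell2D !ell2B !chiE in_setD.
    by case: (x \in F1); case: (x \in B) => /=; rewrite ?subr0 ?addr0 ?subrr ?add0r.
  apply: le_trans (ler_l2normD _ _) _; rewrite mulr2n mulrDl mul1r mulrDl.
  apply: lerD; first exact: F1P.
  by apply: le_trans (chi_le _ _) _.
have Fa : forall xi, l2norm (a xi - a (chi F xi)) <= 2 * c * l2norm xi.
  apply: (@adjoint_bound _ _ _ (fun xi => a xi - chi F (a xi))) => // xi eta.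
  by rewrite dotBl dotBr !(projection_self ap) chi_self.
pose T := compress F a.
have Ta xi : l2norm (T xi - a xi) <= 4 * c * l2norm xi.
  apply: le_trans (ler_l2dist (chi F (a xi)) _ _) _.
  have -> : 4 * c * l2norm xi = 2 * c * l2norm xi + 2 * c * l2norm xi by ring.
  apply: lerD; last by rewrite l2normBC.
  rewrite /T compressE -BopvB; apply: le_trans (chi_le _ _) _.
  by rewrite l2normBC.
have Tself xi eta : dot (T xi) eta = dot xi (T eta).
  by rewrite /T !compressE chi_self projection_self// chi_self.
have TT xi : l2norm (T (T xi) - T xi) <= 2 * c * l2norm xi.
  have -> : T (T xi) - T xi = chi F (a (chi F (a (chi F xi)) - a (chi F xi))).
    by rewrite /T !compressE chi_idem (BopvB a) (projection_idem ap) (BopvB (chi F)).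
  apply: le_trans (chi_le _ _) _; apply: le_trans (projection_le ap _) _.
  rewrite l2normBC; apply: le_trans (aF _) _.
  by rewrite ler_wpM2l ?chi_le// mulr_ge0// ltW.
have c20 : 0 <= 2 * c by rewrite mulr_ge0// ltW.
have [q [qp Fq qF qT]] := almost_projection fF c20 Tself
  (compress_chil F a) (compress_chir F a) TT.
have qa xi : l2norm (q xi - a xi) <= d * l2norm xi.
  apply: le_trans (ler_l2dist (T xi) _ _) _.
  apply: le_trans (lerD (qT xi) (Ta xi)) _.
  rewrite -mulrDl ler_wpM2r ?l2norm_ge0// /c; lra.
(* If [q] were 0, then [a] would be a projection of norm at most [d < 1], hence 0. *)
have q0 : q != 0.
  apply/eqP => q0; have /eqP := spread_out_neq0 s0 abad; apply.
  apply: BopPeq => xi; apply: (projection_small_eq0 ap d1) => eta.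
  by have := qa eta; rewrite q0 Bop0 sub0r l2normN.
exists F, a, q; split => //.
- split => //; apply/set0P/eqP => F0; move/eqP: q0; apply; apply: BopPeq => xi.
  by rewrite -Fq F0 chi_eq0.
- by apply/seteqP; split => x // -[[_ nB]].
- move=> x; rewrite -[q _](subrK (a (delta x))).
  apply: le_trans (ler_l2normD _ _) _; rewrite mulr2n mulrDl mul1r; apply: lerD.
    by apply: le_trans (qa _) _; rewrite l2norm_delta mulr1.
  by apply: le_trans (adelta x) _; rewrite ge_min lexx orbT.
Qed.

Lemma spread_out_block_ghost : exists p,
  [/\ block_projection p, ghost_projection p & ~ compact_op p].
Proof.
(* The errors tend to 0 and are below 1 already at [k = 0]. *)
pose d k : R := k.+2%:R^-1.
have d0 k : 0 < d k by rewrite invr_gt0 ltr0n.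
have d1 k : d k < 1 by rewrite invf_lt1 ?ltr0n// ltr1n.
have dsmall (c : R) : 0 < c -> exists K, forall k, (K <= k)%N -> d k <= c.
  move=> c0; exists (Num.bound c^-1) => k hk.
  rewrite /d -[c]invrK lef_pV2 ?posrE ?invr_gt0 ?ltr0n//.
  have := archi_boundP (ltW (_ : 0 < c^-1)); rewrite invr_gt0 => /(_ c0) h.
  by apply: le_trans (ltW h) _; rewrite ler_nat !leqW.
(* Each choice is a triple: the block, the member of [S], and the rounded projection on the block.
   The blocks chosen earlier form the set to be avoided. *)
have [z zP] := @greedy_sequence X (set X * Bop R X * Bop R X)%type (fun z => z.1.1)
  (fun k B z => [/\ z.1.1 !=set0, z.1.1 `&` B = set0,
    [/\ projection z.2, z.2 != 0, forall xi, chi z.1.1 (z.2 xi) = z.2 xi &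
      forall xi, z.2 (chi z.1.1 xi) = z.2 xi],
    S z.1.2 /\ (forall xi, l2norm (z.2 xi - z.1.2 xi) <= d k * l2norm xi) &
    forall x, l2norm (z.2 (delta x)) <= 2 * d k])
  (fun k B fB => match spread_out_step (d0 k) (d1 k) fB with
    ex_intro F (ex_intro a (ex_intro q (And5 (conj fF F0) FB h3 h4 h5))) =>
      ex_intro2 _ _ (F, a, q) fF (And5 F0 FB h3 h4 h5) end).
pose F k := (z k).1.1; pose a k := (z k).1.2; pose q k := (z k).2.
have fF k : finite_set (F k) by case: (zP k).
have F0 k : F k !=set0 by case: (zP k) => _ [].
have qp k : projection (q k) by case: (zP k) => _ [_ _ []].
have q0 k : q k != 0 by case: (zP k) => _ [_ _ []].
have Fq k xi : chi (F k) (q k xi) = q k xi by case: (zP k) => _ [_ _ []].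
have qF k xi : q k (chi (F k) xi) = q k xi by case: (zP k) => _ [_ _ []].
have Sa k : S (a k) by case: (zP k) => _ [_ _ _ []].
have qa k xi : l2norm (q k xi - a k xi) <= d k * l2norm xi.
  by case: (zP k) => _ [_ _ _ []].
have qd k x : l2norm (q k (delta x)) <= 2 * d k by case: (zP k) => _ [_ _ _ _].
have Flt j k x : (j < k)%N -> F j x -> F k x -> False.
  move=> jk Fj Fk; have [_ [_ + _ _ _]] := zP k => FB.
  suff : (set0 : set X) x by [].
  by rewrite -FB; split => //; exists j.
have tF : trivIset [set: nat] F.
  move=> j k _ _ [x [Fj Fk]]; case: (ltngtP j k) => // h.
    by case: (Flt _ _ _ h Fj Fk).
  by case: (Flt _ _ _ h Fk Fj).
have q1 k xi : l2norm (q k xi) <= 1 * l2norm xi.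
  by rewrite mul1r; exact: projection_le.
have [p [pin pout pM]] := direct_sum tF ler01 Fq qF q1.
have pp : projection p := direct_sum_projection tF Fq qF pin pout qp.
have proe : uniform_roe p.
  apply/uniform_roeP => c c0.
  have qtail c' : 0 < c' -> exists K s, forall n, (K <= n)%N ->
      exists2 b, (prop b <= s%:E)%E &
        forall xi, l2norm (q n xi - b xi) <= c' * l2norm xi.
    move=> c'0; have c2 : 0 < c' / 2 by rewrite divr_gt0.
    have [s _ sP] := Se c2; have [K KP] := dsmall _ c2.
    exists K, s => n Kn; have [b [bs be]] := sP _ (Sa n); exists b => // xi.
    apply: le_trans (ler_l2dist (a n xi) _ _) _.
    rewrite [c']splitr mulrDl; apply: lerD.
      by apply: le_trans (qa n xi) _; rewrite ler_wpM2r ?l2norm_ge0// KP.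
    by rewrite -BopB; exact: l2norm_Bop_bound.
  have [s s0 /choice[b bP]] := equi_tail fF Fq qF qtail c0.
  have bs n : (prop (b n) <= s%:E)%E by case: (bP n).
  have Fd n xi : chi (F n) ((q n - b n) xi) = (q n - b n) xi.
    by rewrite !BopB BopvB Fq; case: (bP n) => _ ->.
  have dF n xi : (q n - b n) (chi (F n) xi) = (q n - b n) xi.
    by rewrite !BopB qF; case: (bP n) => _ _ ->.
  have dM n xi : l2norm ((q n - b n) xi) <= c * l2norm xi.
    by case: (bP n) => _ _ _; exact.
  (* Summing the differences [q n - b n], uniformly bounded by [c], gives [D]. Then [p - D] acts as
     [b n] on each block, has propagation at most [s], and lies within [c] of [p]. *)
  have [D [Din Dout DM]] := direct_sum tF (ltW c0) Fd dF dM.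
  exists (p - D), s; split => //; last first.
    by move=> xi; rewrite BopB opprB addrC subrK; exact: DM.
  apply/propP => x y; rewrite BopB ell2B.
  have [[n _ Fy]|Uy] := pselect ((\bigcup_n F n) y); last first.
    by rewrite pout// Dout// subrr eqxx.
  rewrite (pin n)// (Din n)// BopB ell2B opprB addrC subrK.
  by have /propP := bs n; apply.
exists p; split.
- split => //; exists F; split => // xi.
  exact: (direct_sum_series tF Fq qF pin pout).
- split => // c c0; have c2 : 0 < c / 2 by rewrite divr_gt0.
  have [K KP] := dsmall _ c2; exists (\bigcup_(n in `I_K) F n); split.
    by apply: bigcup_finite => //; exact: finite_II.
  move=> x y Gx _; rewrite entryE.
  have [[n _ Fx]|Ux] := pselect ((\bigcup_n F n) x); last first.
    by rewrite pout// normc0 ltW.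
  rewrite (pin n)//; apply: le_trans (normc_le_l2norm _ _) _.
  apply: le_trans (qd _ _) _; rewrite mulrC -ler_pdivlMr//; apply: KP.
  by rewrite leqNgt; apply/negP => nK; apply: Gx; exists n.
(* Unit vectors fixed by the separate [q k] are pairwise orthogonal and fixed by [p]. *)
- have /choice[u uP] k := projection_fixed_unit (qp k) (q0 k).
  have uF k : chi (F k) (u k) = u k by case: (uP k) => _ <-; rewrite Fq.
  apply: (@not_compact _ _ p u).
  + by move=> k; case: (uP k) => ->.
  + move=> k; rewrite -(uF k) (direct_sum_chir tF Fq qF pin pout) uF.
    by case: (uP k).
  + move=> n m nm; apply: orthogonal_unit_dist; [by case: (uP n)|by case: (uP m)|].
    by rewrite -(uF n) -(uF m) dot_blocks// neq_ltn nm.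
Qed.

End not_ONL.

Lemma no_block_ghost_ONL (R : realType) (X : metricType R) :
  [set: X] !=set0 ->
  ~ (exists p : Bop R X, [/\ block_projection p, ghost_projection p & ~ compact_op p]) ->
  ONL_finite_rank_projections X.
Proof.
move=> X0 nblock e S e0 _ Se Sp; apply: contrapT => nonl; apply: nblock.
(* Lowering [e] to at most 1 makes [1 - e'] non-negative and only weakens the upper bound on
   localised vectors. *)
pose e' := Num.min e 1.
have bad s : 0 < s -> exists2 a, S a & spread_out e' s a.
  move=> s0; apply: contrapT => nbad; apply: nonl; exists s => // a Sa.
  apply: contrapT => h; apply: nbad; exists a => // xi xi1 xis.
  rewrite ltNge; apply/negP => hh; apply: h; exists xi; split => //.
  apply: le_trans hh; rewrite ler_wpM2r ?opnorm_ge0// lerD2l lerN2 ge_min lexx//.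
apply: (@spread_out_block_ghost _ _ S e') => //.
- by rewrite lt_min e0 ltr01.
- by rewrite ge_min lexx orbT.
- by move=> a /Sp[].
- by move=> a /Sp[].
Qed.

(** * Sparse subsets from block projections *)

Section block_to_sparse.
Context {R : realType} {X : metricType R}.
Local Notation H := (ell2 R X).
Implicit Types (xi eta : H) (p : Bop R X).

Context (X_ulf : uniformly_locally_finite X).
Context (p : Bop R X) (pp : projection p) (proe : uniform_roe p) (pg : ghost p).
Context (F : nat -> set X) (tF : trivIset [set: nat] F).
Context (fF : forall n, finite_set (F n)).
Context (pF : forall xi,
  series (fun n => chi (F n) (p (chi (F n) xi))) @ \oo --> p xi).
Local Notation U := (\bigcup_n F n).

Let T n := compress (F n) p.

(** Norm convergence implies convergence of each coordinate, and at a point of [F n] only the term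
    of index [n] contributes. *)
Lemma block_series_in n x xi : F n x -> p xi x = T n xi x.
Proof.
move=> Fx; apply/eqP; rewrite -subr_eq0; apply/eqP/eq0_normc/eqP.
rewrite eq_le normc_ge0 andbT; apply/ler_addgt0Pr => e e0; rewrite add0r.
have /cvg_l2P/(_ e e0)[N NP] := @pF xi.
have := NP (maxn N n.+1) (leq_maxl _ _); apply: le_trans.
apply: le_trans (normc_le_l2norm _ x); rewrite ell2B seriesEord ell2_sum.
have nK : (n < maxn N n.+1)%N by exact: leq_maxr.
rewrite (bigD1 (Ordinal nK))// big1 => [|m mn].
  by rewrite [X in _ <= normc (_ - X)]addr0.
rewrite chi_out// => Fm; have /eqP := mn; apply; apply: val_inj.
exact: (block_index_uniq tF Fm Fx).
Qed.

Lemma block_series_out x xi : ~ U x -> p xi x = 0.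
Proof.
move=> Ux; apply/eq0_normc/eqP.
rewrite eq_le normc_ge0 andbT; apply/ler_addgt0Pr => e e0; rewrite add0r.
have /cvg_l2P/(_ e e0)[N NP] := @pF xi.
have := NP N (leqnn N); apply: le_trans.
apply: le_trans (normc_le_l2norm _ x); rewrite ell2B seriesEord ell2_sum.
rewrite big1 ?subr0// => m _; rewrite chi_out// => Fm; apply: Ux.
by exists (val m).
Qed.

Let p_chi n xi : p (chi (F n) xi) = T n xi.
Proof.
exact: (direct_sum_chir tF (fun n => compress_chil (F n) p)
  (fun n => compress_chir (F n) p) block_series_in block_series_out).
Qed.

Context (pnc : ~ compact_op p).

(** If all blocks from [N] on vanished, the range of [p] would consist of vectors supported on a
    finite set. *)
Lemma infinitely_many_blocks N : exists2 n, (N <= n)%N & T n != 0.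
Proof.
apply: contrapT => h; apply: pnc.
apply: (@localised_compact _ _ p (\bigcup_(n in `I_N) F n) 0 pp ltr01).
  by apply: bigcup_finite => //; exact: finite_II.
move=> xi; rewrite chi_id ?subrr ?l2norm0 ?mul0r// => x nG.
have [[n _ Fx]|Ux] := pselect (U x); last exact: block_series_out.
rewrite (block_series_in _ Fx); case: (ltnP n N) => nN; first by case: nG; exists n.
suff -> : T n = 0 by [].
by apply/eqP/negPn/negP => Tn; apply: h; exists n.
Qed.

(** By uniform local finiteness, the [k]-neighbourhood of the blocks already chosen is finite and
    meets finitely many blocks; a later non-zero block avoids it. *)
Lemma separated_blocks : exists f : nat -> nat, forall k, T (f k) != 0 /\
  forall j x y, (j < k)%N -> F (f j) x -> F (f k) y -> k%:R < mdist x y.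
Proof.
have [|f fP] := @greedy_sequence X nat F (fun k B n => T n != 0 /\
    forall x y, B x -> F n y -> k%:R < mdist x y).
  move=> k B fB; have [K KP] := finite_in_partial F (finite_nbhd X_ulf k%:R fB).
  have [n Kn Tn] := infinitely_many_blocks K; exists n => //; split => // x y Bx Fy.
  rewrite ltNge; apply/negP => xy.
  have [||m mK Fm] := KP y; [by exists x|by exists n|].
  have := leq_trans mK Kn; rewrite (block_index_uniq tF Fm Fy).
  by rewrite ltnn.
exists f => k; have [_ [Tk kP]] := fP k; split => // j x y jk Fx Fy.
by apply: kP => //; exists j.
Qed.

Lemma sparse_noncompact_ghost : exists A : set X, sparse A /\
  exists q : Bop R A, ghost_projection q /\ ~ compact_op q.
Proof.
have [f fP] := separated_blocks.
pose A := \bigcup_k F (f k).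
have far j k x y : j != k -> F (f j) x -> F (f k) y -> (maxn j k)%:R < mdist x y.
  case: (ltngtP j k) => // jk _ Fx Fy.
    by case: (fP k) => _; apply; [exact: jk|exact: Fx|exact: Fy].
  by rewrite metric_sym; case: (fP j) => _; apply; [exact: jk|exact: Fy|exact: Fx].
have spA : sparse A.
  exists (fun k => F (f k)); split => //.
    move=> j k _ _ [x [Fj Fk]]; apply/eqP/negPn/negP => jk.
    by have := far _ _ _ _ jk Fj Fk; rewrite mdistxx ltNge ler0n.
  (* Since [j + k] is at most twice [maxn j k], a large sum forces a large maximum, which bounds the
     distance from below. *)
  move=> r; exists (2 * Num.bound `|r|)%N => j k jk hjk.
  apply: (@lt_le_trans _ _ (maxn j k)%:R%:E); last first.
    by apply: set_dist_ge => x y Fx Fy; apply: ltW; exact: far jk Fx Fy.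
  rewrite lte_fin; apply: le_lt_trans (ler_norm r) _.
  apply: lt_le_trans (archi_boundP (normr_ge0 r)) _; rewrite ler_nat.
  have jk2 : (j + k <= 2 * maxn j k)%N.
    by rewrite mul2n -addnn leq_add ?leq_maxl ?leq_maxr.
  by have := leq_trans hjk jk2; rewrite leq_pmul2l.
exists A; split => //; exists (res_op A p); split.
  split; [exact: res_op_roe| |exact: res_op_ghost].
  apply: res_op_projection => // xi x Ax.
  have [[m _ Fx]|Ux] := pselect (U x); last exact: block_series_out.
  (* A point of [F m] outside [A] shows that [F m] was not chosen; such a block is disjoint from
     [A], where the extended vector lives. *)
  rewrite (block_series_in _ Fx) compressE (_ : chi (F m) (extend xi) = 0).
    by rewrite !linear0.
  apply: chi_eq0 => y Fy; apply: extend_out => -[k _ Fk]; apply: Ax.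
  by exists k => //; rewrite -(block_index_uniq tF Fy Fk).
(* Normalised vectors in the ranges of the chosen blocks are fixed by [p] and remain orthogonal
   after restriction to [A]. *)
have /choice[u uP] k : exists u, [/\ l2norm u = 1, p u = u & chi (F (f k)) u = u].
  have [/projection_neq0_vec[xi /unit_normalize[r r0 r1]] _] := fP k.
  exists (r%:C *: T (f k) xi); split => //; rewrite BopvZ; congr (_ *: _).
    by rewrite -p_chi projection_idem.
  exact: compress_chil.
have uA k : chi A (u k) = u k.
  apply: chi_id => x Ax; case: (uP k) => _ _ <-; rewrite chi_out// => Fx.
  by apply: Ax; exists k.
apply: (@not_compact _ _ _ (fun k => restrict A (u k))).
- by move=> k; rewrite l2norm_restrict uA; case: (uP k) => ->.
- by move=> k; rewrite res_opE restrictK uA; case: (uP k) => _ ->.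
- move=> j k jk; have [uj _ Fj] := uP j; have [uk _ Fk] := uP k.
  rewrite -restrictB l2norm_restrict BopvB !uA.
  apply: orthogonal_unit_dist => //; rewrite -Fj -Fk; apply: dot_disjoint => x.
  have [Fx|Fx] := pselect (F (f j) x); [right|left]; apply: chi_out => // Fx'.
  have := far j k x x; rewrite mdistxx => /(_ _ Fx Fx').
  by rewrite neq_ltn jk => /(_ isT); rewrite ltNge ler0n.
Qed.

End block_to_sparse.

(** * The cycle of implications (1) => (3) => (2) => (1) *)

Theorem theorem1p3 (R : realType) (X : metricType R)
    (X_neq0 : [set: X] !=set0) (X_ulf : uniformly_locally_finite X) :
  let stmt1 := ~ exists p : Bop R X,
    [/\ block_projection p, ghost_projection p & ~ compact_op p] in
  let stmt2 := forall X' : set X, sparse X' ->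
    forall p : Bop R X', ghost_projection p -> compact_op p in
  let stmt3 := ONL_finite_rank_projections X in
  (stmt1 <-> stmt2) /\ (stmt2 <-> stmt3).
Proof.
move=> stmt1 stmt2 stmt3.
have h13 : stmt1 -> stmt3 by exact: no_block_ghost_ONL.
have h32 : stmt3 -> stmt2 by move=> h; exact: ONL_sparse_ghost_compact.
have h21 : stmt2 -> stmt1.
  move=> h [p [[_ _ [F [tF fF _ pF]]] [proe pp pg] pnc]].
  have [A [spA [q [qg qnc]]]] := sparse_noncompact_ghost X_ulf pp proe pg tF fF pF pnc.
  by apply: qnc; exact: h.
by split; split; [move/h13/h32|exact: h21|move/h21/h13|exact: h32].
Qed.
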